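(* Let $n\in\mathbb{N}^+$ and let $K$ be a compact metric space with $\dim_t K\geq n$. Then for the generic $f\in C_n(K)$, $$\max_{y\in\mathbb{R}^n}\dim_H f^{-1}(y)=\dim_{t^nH}K-n;$$ in particular, the maximum is attained.
   Context: $\mathbb{N}=\{0,1,2,\dots\}$ and $\mathbb{N}^+=\{1,2,\dots\}$. $\dim_H$ is Hausdorff dimension, with the convention $\dim_H\emptyset=-1$. $\dim_t$ is the small inductive topological dimension: $\dim_t\emptyset=-1$ and, for a non-empty metric space $X$, $\dim_t X=\inf\{d: X \text{ has a basis } \mathcal{U} \text{ such that } \dim_t\partial U\leq d-1 \text{ for every } U\in\mathcal{U}\}$. The $n$th inductive topological Hausdorff dimension is defined by $\dim_{t^nH}\emptyset=-1$ for all $n\in\mathbb{N}$, and for non-empty $X$ by $\dim_{t^0H}X=\dim_H X$ and, for $n\geq 1$, $\dim_{t^nH}X=\inf\{d: X\text{ has a basis }\mathcal{U}\text{ such that }\dim_{t^{n-1}H}\partial U\leq d-1\text{ for every }U\in\mathcal{U}\}$. All these dimensions may take the value $\infty$ (so $d=\infty$ is allowed in the infima), with $\infty-c=\infty$ for finite $c$. $C_n(K)$ is the complete metric space of continuous functions $K\to\mathbb{R}^n$ with the supremum norm. A property holds for the generic element of a complete metric space if the set of elements having it is co-meager. *)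

(* Defs.v *)
From HB Require Import structures.
From mathcomp Require Import all_boot all_order all_algebra.
From mathcomp Require Import all_classical all_reals all_analysis.
Set Implicit Arguments.
Unset Strict Implicit.
Unset Printing Implicit Defensive.
Import Order.TTheory GRing.Theory Num.Theory.
Import numFieldNormedType.Exports.

Local Open Scope classical_set_scope.
Local Open Scope ring_scope.

(* Subsets of a metric space carry the restricted distance; the library already
   equips [set_type A] with the corresponding topology and balls. *)
Section set_type_metric.
Context {R : realType} {X : metricType R} (A : set X).

Let d (x y : A) : R := mdist (set_val x) (set_val y).

Let d_ge0 x y : 0 <= d x y.
Proof. exact: mdist_ge0. Qed.

Let d_positivity x y : d x y = 0 -> x = y.
Proof. by move=> /mdist_positivity; exact: val_inj. Qed.

Let ballEd (x : A) (e : R) : ball x e = [set y | d x y < e].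
Proof. by rewrite -initial_ballE ballEmdist. Qed.

HB.instance Definition _ :=
  @PseudoMetric_isMetric.Build R (set_type A) d d_ge0 d_positivity ballEd.

End set_type_metric.

Section topology.
Context {T : topologicalType}.
Implicit Types A : set T.

Definition boundary A : set T := closure A `\` A°.

Definition nowhere_dense A := (closure A)° = set0.

Definition meager A :=
  exists2 F : (set T)^nat, (forall i, nowhere_dense (F i)) & A = \bigcup_i F i.

Definition comeager A := meager (~` A).

End topology.

Section hausdorff_dimension.
Context {R : realType} {X : metricType R}.
Implicit Types (A : set X) (s delta : R).
Local Open Scope ereal_scope.

(* The added 0 gives the empty set diameter 0 instead of -oo. *)
Definition diam A : \bar R :=
  ereal_sup (0 |` [set (mdist x y)%:E | x in A & y in A]).

(* For s = 0 the empty set has weight 0 and a singleton has weight 0 ^ 0 = 1. *)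
Definition diam_pow s A : \bar R :=
  if A == set0 then 0 else poweR (diam A) s.

Definition hausdorff_premeasure s delta A : \bar R :=
  ereal_inf [set \sum_(0 <= i <oo) diam_pow s (U i) | U in
    [set U : (set X)^nat | A `<=` \bigcup_i U i /\
                           forall i, diam (U i) <= delta%:E]].

(* The premeasure is nonincreasing in delta, so the supremum is its limit at
   0+. *)
Definition hausdorff_measure s A : \bar R :=
  ereal_sup [set hausdorff_premeasure s delta A |
              delta in [set delta | (0 < delta)%R]].

Definition hausdorff_dim A : \bar R :=
  if A == set0 then -1
  else ereal_inf [set s%:E | s in [set s | (0 <= s)%R /\
                                           hausdorff_measure s A < +oo]].

End hausdorff_dimension.

(* [ind_lt k X] stands for [dim_t X <= k - 1]. *)
Fixpoint ind_lt (k : nat) (X : topologicalType) : Prop :=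
  match k with
  | 0 => [set: X] = set0
  | k'.+1 => exists2 B : set (set X),
      basis B & forall U, B U -> ind_lt k' (boundary U)
  end.

(* The equation defining the small inductive dimension has the dimension itself
   on both sides; it is resolved by recursion on the bound, and [ind_dimE] below
   recovers the equation. *)
Definition ind_dim (R : realType) (X : topologicalType) : \bar R :=
  ereal_inf [set (k%:R - 1)%:E | k in [set k | ind_lt k X]].

Fixpoint ind_hausdorff_dim {R : realType} (n : nat) (X : metricType R) :
    \bar R :=
  if [set: X] == set0 then (-1)%E else
  match n with
  | 0 => hausdorff_dim [set: X]
  | n'.+1 => ereal_inf [set d : \bar R | exists2 B : set (set X),
      basis B & forall U, B U ->
        (ind_hausdorff_dim n' (boundary U) <= d - 1)%E]
  end.

Section ind_dim_lemmas.
Context {R : realType}.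
Implicit Types X : topologicalType.
Local Open Scope ereal_scope.

Lemma set_type_eq0 X (A : set X) : A = set0 -> [set: A] = set0.
Proof. by rewrite -!subset0 => A0 x _; exact: A0 (set_valP x). Qed.

Lemma ind_ltS k X : ind_lt k X -> ind_lt k.+1 X.
Proof.
elim: k X => [X X0|k IH X [B bB HB]]; last by exists B => // U /HB/IH.
exists open; last by move=> U _; apply: set_type_eq0; rewrite -subset0 => x _;
  have : [set: X] x by []; rewrite X0.
split=> // x V; rewrite nbhsE => -[W [oW Wx] WV]; exists W => //.
Qed.

Lemma ind_lt_le j k X : (j <= k)%N -> ind_lt j X -> ind_lt k X.
Proof.
move=> /subnK <-; elim: (k - j)%N => // i IH jX.
by rewrite addSn; apply: ind_ltS; exact: IH.
Qed.

Lemma ind_ltP k X : ind_lt k X <-> ind_dim R X <= (k%:R - 1)%:E.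
Proof.
split=> [kX|]; first by apply: ereal_inf_lbound; exists k.
move=> kX; have : ind_dim R X < k%:R%:E.
  by rewrite (le_lt_trans kX)// lte_fin ltrBlDr ltrDl.
move=> /ereal_inf_lt[_ [j jX <-]]; rewrite lte_fin ltrBlDr natr1 ltr_nat ltnS.
by move=> jk; exact: ind_lt_le jX.
Qed.

Lemma ind_dim_ge_N1 X : -1 <= ind_dim R X.
Proof.
by apply: le_ereal_inf_tmp => _ [k _ <-]; rewrite lee_fin lerBrDr addNr.
Qed.

Lemma ind_dimE X : ind_dim R X =
  if [set: X] == set0 then -1 else
  ereal_inf [set d : \bar R | exists2 B : set (set X),
    basis B & forall U, B U -> ind_dim R (boundary U) <= d - 1].
Proof.
case: eqP => [X0|/eqP/set0P[x _]].
  apply/eqP; rewrite eq_le ind_dim_ge_N1 andbT.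
  by have /ind_ltP := X0 : ind_lt 0 X; rewrite sub0r.
apply/eqP; rewrite eq_le; apply/andP; split; last first.
  apply: le_ereal_inf_tmp => _ [[|k] kX <-].
    by have : [set: X] x by []; rewrite [in X in X -> _]kX.
  case: kX => B bB HB; apply: ereal_inf_lbound; exists B => // U /HB/ind_ltP.
  by rewrite -natr1 addrK.
apply: le_ereal_inf_tmp => d [B bB HB].
have [U [BU Ux]] : exists U, B U /\ U x.
  have [_ /(_ x)] := bB => /(_ setT filterT)[U [BU Ux] _].
  by exists U.
have := le_trans (ind_dim_ge_N1 _) (HB U BU).
case: d HB => [d| |] HB; last 2 first.
- by move=> _; exact: leey.
- by rewrite addNye leeNy_eq.
rewrite -EFinB lee_fin lerBrDr addNr => d0.
have : ind_lt (Num.truncn d).+1 X.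
  exists B => // V /HB dV.
  have : ind_dim R (boundary V) < (Num.truncn d)%:R%:E.
    rewrite (le_lt_trans dV)// -EFinB lte_fin ltrBlDr natr1.
    by rewrite truncnS_gt.
  move=> /ereal_inf_lt[_ [j jV <-]].
  rewrite lte_fin ltrBlDr natr1 ltr_nat ltnS => jd.
  exact: ind_lt_le jV.
move=> /ind_ltP/le_trans; apply.
by rewrite -natr1 addrK lee_fin truncn_le.
Qed.

End ind_dim_lemmas.

Section cont_fun_topology.
Import ArrowAsUniformType.

(* [continuousType K 'rV[R]_n], with the topology of uniform convergence, is
   C_n(K): [`|_|] is the maximum norm of R^n, which induces the same topology on
   C_n(K) as the Euclidean one. *)
Lemma nbhs_continuousTypeE (R : realType) (K : topologicalType) (n : nat)
    (f : continuousType K 'rV[R]_n) (A : set (continuousType K 'rV[R]_n)) :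
  nbhs f A <-> exists2 e : R, 0 < e &
    [set g : continuousType K 'rV[R]_n | forall x, `|f x - g x| < e] `<=` A.
Proof.
rewrite -nbhs_entourageE /=; split=> [[E [V [W]]]|[e e0 eA]].
- rewrite -entourage_ballE => -[e e0 eW] WV VE EA.
  exists e => // g fg; apply: EA; apply/mem_set/VE/WV => x /=.
  by apply: eW => /=; rewrite -ball_normE; exact: fg.
- exists [set fg : continuousType K 'rV[R]_n * continuousType K 'rV[R]_n |
    forall x, ball (fg.1 x) e (fg.2 x)].
    exists [set fg : (K -> 'rV[R]_n) * (K -> 'rV[R]_n) |
      forall x, ball (fg.1 x) e (fg.2 x)] => //.
    exists [set yz | ball yz.1 e yz.2] => //.
    by rewrite -entourage_ballE; exists e.
  move=> g /set_mem/= fg; apply: eA => x /=.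
  by have := fg x; rewrite -ball_normE.
Qed.

End cont_fun_topology.

(* Main.v *)
Require Import Defs.
From mathcomp Require Import all_boot all_order all_algebra.
From mathcomp Require Import all_classical all_reals all_analysis.
From mathcomp Require Import ring lra.
Import Order.TTheory GRing.Theory Num.Theory.
Import numFieldNormedType.Exports.
Import ArrowAsUniformType.
Set Implicit Arguments.
Unset Strict Implicit.
Unset Printing Implicit Defensive.

Local Open Scope classical_set_scope.
Local Open Scope ring_scope.

(** Upper bound, by induction on n. Cover K by small basic open sets whose
    boundaries have small dimension. By induction a generic map to R^(n-1) has
    H^s-null fibers on the union F of these boundaries, hence, by compactness,
    fibers with small s-content on a neighborhood N of F. Off N the space
    splits into small disjoint closed pieces, and the last coordinate can be
    perturbed to take a different constant value on each of them.

    Lower bound. Call C negligible for s if a dense set of f has an almost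
    H^s-null set {f = 0} in C. A Baire argument then gives a sequence of
    functions g_i such that every n of them have an H^s-null common zero set in
    C and such that the sets {g_i < 0} form a basis even after finitely many
    indices are dropped; iterated boundaries lie in common zero sets, so the
    dimension of C is at most s + n. By compactness some point x0 has no
    neighborhood that is negligible for an s < dim K - n. Near x0 any f can be
    perturbed to f(x0) + lambda g on an annulus, where g witnesses
    non-negligibility; this makes the fiber through x0 large, robustly. So
    y = f(x0) attains the maximum for generic f. *)

(** * Coverings by balls and Hausdorff dimension *)

(** Near-covering compactness, applied to the filter on lists generated by the sets of all lists
    that extend a given one. *)
Lemma compact_seq_cover (T : topologicalType) (I : eqType) (A : set T)
    (U : I -> set T) :
    compact A -> (forall x, A x -> exists i, nbhs x (U i)) ->
  exists l : seq I, forall x, A x -> exists2 i, i \in l & U i x.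
Proof.
move=> /compact_near_coveringP cA AU.
pose F : set_system (seq I) :=
  [set S | exists l0 : seq I, forall l : seq I, {subset l0 <= l} -> S l].
have FF : Filter F.
  split; first by exists [::].
  - move=> P Q [lP hP] [lQ hQ]; exists (lP ++ lQ) => l ll; split.
      by apply: hP => i il; apply: ll; rewrite mem_cat il.
    by apply: hQ => i il; apply: ll; rewrite mem_cat il orbT.
  - by move=> P Q PQ [l hl]; exists l => k kl; exact/PQ/hl.
have [x Ax|l hl] := cA _ F (fun l x => exists2 i, i \in l & U i x) FF.
  have [i Ui] := AU _ Ax.
  exists (U i, [set l : seq I | i \in l]) => /=.
    by split=> //; exists [:: i] => l; apply; rewrite mem_head.
  by move=> [y l] /= [Uy il]; exists i.
by exists l; exact: hl.
Qed.

Lemma closed_sublevel (T : topologicalType) (R : realType) (f : T -> R) (a : R) :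
  continuous f -> closed [set z | f z <= a].
Proof.
move=> cf; rewrite (_ : [set z | _] = f @^-1` [set y | y <= a]) //.
by apply: preimage_closed => //; exact: closed_le.
Qed.

Lemma powR_le_small (R : realType) (s e : R) : 0 < s -> 0 < e ->
  exists r, [/\ 0 < r, r <= e & r `^ s <= e].
Proof.
move=> s0 e0; exists (Num.min e (e `^ s^-1)); split.
- by rewrite lt_min e0 powR_gt0.
- by rewrite ge_min lexx.
- rewrite (@le_trans _ _ ((e `^ s^-1) `^ s))//.
    rewrite ge0_ler_powR ?nnegrE ?powR_ge0 ?ge_min ?lexx ?orbT//; first exact: ltW.
    by rewrite le_min (ltW e0) powR_ge0.
  by rewrite -powRrM mulVf ?gt_eqF// powRr1// ltW.
Qed.

Lemma nbhs_mdist (R : realType) (X : metricType R) (x : X) (P : set X) :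
  nbhs x P <-> exists2 r : R, 0 < r & forall y, mdist x y < r -> P y.
Proof. exact: metricType_numDomainType.nbhs_mdistP. Qed.

Section coverings.
Context {R : realType} {K : metricType R}.
Implicit Types (E : set K) (s e : R) (l : seq (K * R)).

Definition balls l : set K :=
  [set x | has (fun p => mdist p.1 x < p.2) l].

(* Arbitrarily small [e] characterizes H^s-null sets, because [e] bounds both
   the radii and the total weight. *)
Definition scover s e E := exists l, [/\ all (fun p => 0 < p.2 <= e) l,
  \sum_(p <- l) p.2 `^ s <= e & E `<=` balls l].

Lemma open_balls l : open (balls l).
Proof.
rewrite openE => x /hasP[p pl px]; rewrite /interior.
apply/nbhs_mdist; exists (p.2 - mdist p.1 x); first by rewrite subr_gt0.
move=> y xy; apply/hasP; exists p => //=.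
by rewrite (le_lt_trans (metric_triangle _ x _))// -ltrBrDl.
Qed.

Lemma scoverS s e E E' : E `<=` E' -> scover s e E' -> scover s e E.
Proof.
by move=> EE' [l [l1 l2 l3]]; exists l; split=> //; exact: subset_trans l3.
Qed.

Lemma scover_balls s e E : scover s e E ->
  exists l, E `<=` balls l /\ scover s e (balls l).
Proof. by move=> [l [l1 l2 l3]]; exists l; split=> //; exists l; split. Qed.

Lemma scover0 s e : 0 <= e -> scover s e set0.
Proof. by move=> e0; exists [::]; split=> //; rewrite big_nil. Qed.

Lemma scover_ball s e x : 0 < s -> 0 < e ->
  exists2 r, 0 < r & scover s e [set y | mdist x y < r].
Proof.
move=> s0 e0; have [r [r0 re res]] := powR_le_small s0 e0.
exists r => //; exists [:: (x, r)]; split=> /=; rewrite ?r0 ?re// ?big_seq1//.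
by move=> y /= xy; rewrite /balls /= xy.
Qed.

Lemma scoverU s e1 e2 E1 E2 : scover s e1 E1 -> scover s e2 E2 ->
  0 <= e1 -> 0 <= e2 -> scover s (e1 + e2) (E1 `|` E2).
Proof.
move=> [l1 [a1 b1 c1]] [l2 [a2 b2 c2]] e1_ge0 e2_ge0.
exists (l1 ++ l2); split.
- rewrite all_cat; apply/andP; split; apply/allP => p.
    move=> /(allP a1)/andP[-> /=] /le_trans; apply; by rewrite lerDl.
  by move=> /(allP a2)/andP[-> /=] /le_trans; apply; rewrite lerDr.
- by rewrite big_cat lerD.
- by move=> x [/c1|/c2]; rewrite /balls /= has_cat => ->//; rewrite orbT.
Qed.

End coverings.

Section hausdorff_dim_scover.
Context {R : realType} {X K : metricType R} (phi : X -> K).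
Hypothesis iso : forall x y, mdist (phi x) (phi y) = mdist x y.
Implicit Types (A : set X) (s e : R).

Lemma diam_ge0 A : (0 <= diam A)%E.
Proof. by apply: ereal_sup_ubound; left. Qed.

Lemma diam_mdist A x y : A x -> A y -> ((mdist x y)%:E <= diam A)%E.
Proof. by move=> Ax Ay; apply: ereal_sup_ubound; right; exists x => //; exists y. Qed.

Lemma diam_pow_ge0 s A : (0 <= diam_pow s A)%E.
Proof. by rewrite /diam_pow; case: ifP => // _; exact: poweR_ge0. Qed.

Lemma diam_preimage_ball c r : 0 <= r ->
  (diam [set x | (mdist c (phi x) < r)%R] <= (2 * r)%:E)%E.
Proof.
move=> r0; apply: ge_ereal_sup => _ [->|[x /= xr [y /= yr <-]]].
  by rewrite lee_fin mulr_ge0.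
rewrite lee_fin -iso (le_trans (metric_triangle _ c _))// metric_sym.
by have := ltW xr; have := ltW yr; lra.
Qed.

Lemma hausdorff_measure0 s A : 0 < s ->
  (forall e, 0 < e -> scover s e (phi @` A)) -> (hausdorff_measure s A <= 0)%E.
Proof.
move=> s0 sA; apply: ge_ereal_sup => _ [delta /= delta0 <-].
apply/lee_addgt0Pr => e e0; rewrite add0e.
(* Doubling the radii multiplies the weight by [c]. The bound [e'] keeps diameters below [delta] and
   the total weight below [e]. *)
pose c : R := 2 `^ s; have c0 : 0 < c by rewrite powR_gt0.
pose e' := Num.min (delta / 2) (e / c).
have e'0 : 0 < e' by rewrite lt_min !divr_gt0.
have [l [/allP l1 l2 l3]] := sA _ e'0.
pose U i : set X := if onth l i is Some p then
  [set x | mdist p.1 (phi x) < p.2] else set0.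
pose F (p : K * R) := (2 * p.2) `^ s.
pose w i := if onth l i is Some p then F p else 0.
have lP i p : onth l i = Some p -> 0 < p.2 /\ p.2 <= e'.
  move=> E; have /l1/andP[] // : p \in l by apply/onthP; exists i.
have e'd : 2 * e' <= delta.
  by rewrite mulrC -ler_pdivlMr// ge_min lexx.
have dU i : (diam (U i) <= delta%:E)%E.
  rewrite /U; case E : (onth l i) => [p|].
    have [p0 pe] := lP _ _ E.
    rewrite (le_trans (diam_preimage_ball _ (ltW p0)))// lee_fin.
    by rewrite (le_trans _ e'd)// ler_pM2l.
  by apply: ge_ereal_sup => _ [->|[x []]]; rewrite lee_fin ltW.
have Uw i : (diam_pow s (U i) <= (w i)%:E)%E.
  rewrite /U /w; case E : (onth l i) => [p|].
    have [p0 _] := lP _ _ E.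
    rewrite /diam_pow; case: ifP => _; first by rewrite lee_fin powR_ge0.
    rewrite /F -poweR_EFin gt0_ler_poweR ?(ltW s0)// ?in_itv/= ?leey ?andbT.
    - exact: diam_ge0.
    - by rewrite lee_fin mulr_ge0// ltW.
    - exact: diam_preimage_ball (ltW p0).
  by rewrite /diam_pow eqxx.
have sumw N : \sum_(0 <= i < N) w i <= \sum_(p <- l) F p.
  rewrite /w; elim: (l) N => [|p l' IH] N.
    by rewrite big_nil big1// => i _; rewrite onth0n.
  case: N => [|N]; last by rewrite big_nat_recl// big_cons lerD.
  by rewrite big_geq// sumr_ge0// => q _; exact: powR_ge0.
apply: (@le_trans _ _ (\sum_(0 <= i <oo) diam_pow s (U i))%E).
  apply: ereal_inf_lbound; exists U => //; split=> // x Ax.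
  have /l3 : (phi @` A) (phi x) by exists x.
  move=> /hasP[p /onthP[i pi] px]; exists i => //.
  by rewrite /U pi.
apply: lime_le; first by apply: is_cvg_nneseries => i _ _; exact: diam_pow_ge0.
apply: nearW => N; apply: (@le_trans _ _ (\sum_(0 <= i < N) w i)%:E).
  by rewrite -sumEFin; apply: lee_sum => i _; exact: Uw.
rewrite lee_fin (le_trans (sumw N))//.
have -> : \sum_(p <- l) F p = c * \sum_(p <- l) p.2 `^ s.
  rewrite mulr_sumr; apply: eq_big_seq => p /l1/andP[p0 _].
  by rewrite /F powRM// ltW.
by rewrite mulrC -ler_pdivlMr// (le_trans l2)// ge_min lexx orbT.
Qed.

Lemma hausdorff_dim_le A s : 0 <= s ->
  (forall s' e, s < s' -> 0 < e -> scover s' e (phi @` A)) ->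
  (hausdorff_dim A <= s%:E)%E.
Proof.
move=> s0 sA; rewrite /hausdorff_dim; case: ifP => _.
  by rewrite lee_fin; lra.
apply/lee_addgt0Pr => e e0; apply: ereal_inf_lbound => /=.
exists (s + e) => //; split; first by rewrite addr_ge0// ltW.
apply: (@le_lt_trans _ _ 0%E); last exact: ltey.
apply: hausdorff_measure0 => [|e' e'0]; first by rewrite ltr_wpDl.
by apply: sA => //; rewrite ltrDl.
Qed.

Lemma hausdorff_dim_ge0 A : A !=set0 -> (0 <= hausdorff_dim A)%E.
Proof.
move=> /set0P A0; rewrite /hausdorff_dim (negbTE A0).
by apply: le_ereal_inf_tmp => _ [s [s0 _] <-]; rewrite lee_fin.
Qed.

(** A cover by sets of diameter at most [d] with finite weight for an exponent [s1 < s] has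
    [s]-weight smaller by the factor [d ^ (s - s1)]. Each set is replaced by a ball around one of
    its points, and compactness keeps finitely many balls. *)
Lemma scover_hausdorff_dim A s e : compact (phi @` A) -> 0 < s -> 0 < e ->
  (hausdorff_dim A < s%:E)%E -> scover s e (phi @` A).
Proof.
move=> cA s0 e0; rewrite /hausdorff_dim; case: ifP => [/eqP ->|_].
  by rewrite image_set0 => _; exact/scover0/ltW.
have [->|/set0P[a0 Aa0]] := eqVneq A set0.
  by rewrite image_set0 => _; exact/scover0/ltW.
move=> /ereal_inf_lt[_ [s1 [s1_ge0 As1] <-]]; rewrite lte_fin => s1s.
have [M M0 AM] : exists2 M : R, 0 <= M & (hausdorff_measure s1 A <= M%:E)%E.
  move: As1; case: hausdorff_measure => [r _|//|_].
    by exists `|r| => //; rewrite lee_fin ler_norm.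
  by exists 0 => //; rewrite leNye.
pose c : R := 2 `^ s; have c0 : 0 < c by rewrite powR_gt0.
have [d0 [d0_gt0 _ d0P]] : exists d : R, [/\ 0 < d, d <= e / (2 * c * (M + 1)) &
    d `^ (s - s1) <= e / (2 * c * (M + 1))].
  by apply: powR_le_small; rewrite ?subr_gt0// divr_gt0// !mulr_gt0//; lra.
pose d := Num.min d0 (e / 2).
have d_gt0 : 0 < d by rewrite lt_min d0_gt0 divr_gt0.
have dP : d `^ (s - s1) * (c * (M + 1)) <= e / 2.
  rewrite -ler_pdivlMr; last by rewrite mulr_gt0//; lra.
  apply: (@le_trans _ _ (d0 `^ (s - s1))).
    rewrite ge0_ler_powR ?nnegrE ?ge_min ?lexx//; try exact: ltW.
    by rewrite subr_ge0 ltW.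
  by rewrite (le_trans d0P)// -mulrA invfM mulrA.
have : (hausdorff_premeasure s1 d A < (M + 1)%:E)%E.
  apply: (@le_lt_trans _ _ M%:E); last by rewrite lte_fin ltrDl.
  by apply: le_trans AM; apply: ereal_sup_ubound; exists d.
move=> /ereal_inf_lt[_ [U [AU dU] <-]] UM.
pose D i := fine (diam (U i)).
have DE i : diam (U i) = (D i)%:E.
  rewrite /D fineK// ge0_fin_numE ?diam_ge0//.
  by rewrite (le_lt_trans (dU i))// ltry.
have D0 i : 0 <= D i by rewrite -lee_fin -DE diam_ge0.
have Dd i : D i <= d by rewrite -lee_fin -DE.
have /choice[t tP] : forall i : nat, exists r : R, [/\ 0 < r, r <= e / 2 ^+ i.+2 &
    r `^ s <= e / 2 ^+ i.+2].
  by move=> i; apply: powR_le_small => //; rewrite divr_gt0// exprn_gt0.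
have t_gt0 i : 0 < t i by case: (tP i).
(* The factor 2 puts the set strictly inside its ball if [D i > 0]; the summable [t i] gives sets of
   diameter 0 a positive radius. *)
pose r i := Num.max (2 * D i) (t i).
have r_gt0 i : 0 < r i by rewrite lt_max t_gt0 orbT.
have rs i : r i `^ s <= (2 * D i) `^ s + t i `^ s.
  rewrite /r; case: (leP (2 * D i) (t i)) => _; first by rewrite lerDr powR_ge0.
  by rewrite lerDl powR_ge0.
have Ds i : ((D i `^ s)%:E <= (d `^ (s - s1))%:E * diam_pow s1 (U i))%E.
  have [D_eq0|D_neq0] := eqVneq (D i) 0.
    rewrite D_eq0 powR0 ?gt_eqF// mule_ge0 ?diam_pow_ge0// lee_fin powR_ge0//.
  rewrite /diam_pow ifF; last first.
    apply/eqP => U0; case/eqP: D_neq0; apply/eqP; rewrite eq_le D0 andbT.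
    rewrite -lee_fin -DE U0; apply: ge_ereal_sup => _ [->//|[x []]].
  rewrite DE poweR_EFin -EFinM lee_fin.
  rewrite -[in leLHS](subrK s1 s) (@powRD _ (D i)); last by rewrite D_neq0 implybT.
  rewrite ler_wpM2r ?powR_ge0// ge0_ler_powR ?nnegrE//; last exact: ltW.
  by rewrite subr_ge0 ltW.
have sumD N : \sum_(0 <= i < N) D i `^ s <= d `^ (s - s1) * (M + 1).
  rewrite -lee_fin -sumEFin EFinM.
  apply: (@le_trans _ _ (\sum_(0 <= i < N) (d `^ (s - s1))%:E * diam_pow s1 (U i))%E).
    by apply: lee_sum => i _; exact: Ds.
  rewrite -ge0_sume_distrr; last by move=> i _; exact: diam_pow_ge0.
  rewrite lee_wpmul2l ?lee_fin ?powR_ge0// (le_trans _ (ltW UM))//.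
  by apply: nneseries_lim_ge => i _ _; exact: diam_pow_ge0.
have sumt N : \sum_(0 <= i < N) t i `^ s <= e / 2.
  apply: (@le_trans _ _ (e / 2 - e / 2 ^+ N.+1)); last first.
    by rewrite gerBl divr_ge0 ?(ltW e0)// exprn_ge0.
  elim: N => [|N IH]; first by rewrite big_geq// expr1 subrr.
  rewrite big_nat_recr//=; have [_ _ tN] := tP N.
  rewrite (le_trans (lerD IH tN))// le_eqVlt; apply/orP; left; apply/eqP.
  by rewrite [2 ^+ N.+2]exprS; field; rewrite expf_neq0.
have /choice[p pP] : forall i, exists x, U i !=set0 -> exists2 u, U i u & x = phi u.
  move=> i; have [[u Uu]|nU] := pselect (U i !=set0).
    by exists (phi u) => _; exists u.
  by exists (phi a0).
have [|l lP] := @compact_seq_cover _ nat (phi @` A)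
    (fun i => [set x | mdist (p i) x < r i]) cA.
  move=> _ [a Aa <-]; have [i _ Ui] := AU a Aa; exists i.
  have /pP[u Uu pi] : U i !=set0 by exists a.
  suff : mdist (p i) (phi a) < r i.
    move=> pa; apply/nbhs_mdist; exists (r i - mdist (p i) (phi a)).
      by rewrite subr_gt0.
    move=> y ay; rewrite /= (le_lt_trans (metric_triangle _ (phi a) _))//.
    by rewrite -ltrBrDl.
  have uD : mdist u a <= D i by rewrite -lee_fin -DE diam_mdist.
  rewrite pi iso (le_lt_trans uD)// /r lt_max.
  have [Di0|Di0] := eqVneq (D i) 0; first by rewrite Di0 t_gt0 orbT.
  have : 0 < D i by rewrite lt_neqAle eq_sym Di0 D0.
  by move=> ?; apply/orP; left; lra.
(* All indices up to the largest selected one are kept: [l] may repeat indices, whereas initial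
   segments obey the bounds [sumD] and [sumt]. *)
pose N := (\max_(i <- l) i).+1.
exists [seq (p i, r i) | i <- index_iota 0 N]; split.
- apply/allP => _ /mapP[i _ ->] /=; rewrite r_gt0/= /r ge_max; apply/andP; split.
    have : d <= e / 2 by rewrite ge_min lexx orbT.
    by have := Dd i; lra.
  have [_ ti _] := tP i; rewrite (le_trans ti)// ler_pdivrMr ?exprn_gt0//.
  by rewrite ler_peMr ?(ltW e0)// exprn_ege1// ler1n.
- rewrite big_map /=.
  apply: (@le_trans _ _ (\sum_(0 <= i < N) ((2 * D i) `^ s + t i `^ s))).
    exact: ler_sum.
  rewrite big_split/=.
  rewrite (_ : \sum_(0 <= i < N) _ = c * \sum_(0 <= i < N) D i `^ s).
    rewrite [leRHS]splitr lerD// (le_trans _ dP)// mulrCA.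
    by rewrite ler_pM2l.
  by rewrite mulr_sumr; apply: eq_bigr => i _; rewrite powRM.
- move=> x /lP[i il xi]; apply/hasP; exists (p i, r i); last exact: xi.
  apply/mapP; exists i => //; rewrite mem_index_iota /= ltnS.
  by rewrite leq_bigmax_seq.
Qed.

End hausdorff_dim_scover.

(** * Open and dense properties of sequences of functions *)

Lemma continuous_distP (R : realType) (T : topologicalType) (f : T -> R) :
  continuous f <-> forall x e, 0 < e -> nbhs x [set z | `|f x - f z| < e].
Proof.
split=> [cf x e e0|H x]; first by move/cvgrPdist_lt: (cf x); exact.
by apply/cvgrPdist_lt => e e0; exact: H.
Qed.

Lemma nbhs_seq_forall (T : topologicalType) (I : eqType) (l : seq I)
    (P : I -> set T) (x : T) : (forall i, i \in l -> nbhs x (P i)) ->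
  nbhs x [set z | forall i, i \in l -> P i z].
Proof.
elim: l => [|i l IH] H; first by apply: (@filterS _ (nbhs x) _ setT) => //; exact: filterT.
have Hl : nbhs x [set z | forall j, j \in l -> P j z].
  by apply: IH => j jl; apply: H; rewrite inE jl orbT.
apply: filterS2 (H i (mem_head _ _)) Hl => z Pi Pl j; rewrite inE => /predU1P[->//|]; exact: Pl.
Qed.

Lemma nbhs_nat_forall (T : topologicalType) (n : nat) (P : nat -> set T) (x : T) :
  (forall i, (i < n)%N -> nbhs x (P i)) ->
  nbhs x [set z | forall i, (i < n)%N -> P i z].
Proof.
move=> H; have : nbhs x [set z | forall i, i \in iota 0 n -> P i z].
  by apply: nbhs_seq_forall => i; rewrite mem_iota => /H.
by apply: filterS => z Pz i i_n; apply: Pz; rewrite mem_iota.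
Qed.

Lemma open_seq_forall (T : topologicalType) (I : eqType) (l : seq I)
    (P : I -> set T) : (forall i, open (P i)) ->
  open [set z | forall i, i \in l -> P i z].
Proof.
move=> oP; rewrite openE => z Pz; apply: nbhs_seq_forall => i il.
by apply: open_nbhs_nbhs; split; [exact: oP|exact: Pz].
Qed.

Lemma seq_lower_bound (R : realType) (I : eqType) (l : seq I) (r : I -> R) :
  (forall i, 0 < r i) -> exists2 d, 0 < d & forall i, i \in l -> d <= r i.
Proof.
move=> r0; elim: l => [|i l [d d0 H]]; first by exists 1.
exists (Num.min d (r i)); first by rewrite lt_min d0 r0.
move=> j; rewrite inE => /predU1P[->|/H jl]; first by rewrite ge_min lexx orbT.
by rewrite ge_min jl.
Qed.

Section sequences_of_functions.
Context {R : realType} {K : topologicalType}.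
Implicit Types f g h : nat -> K -> R.

Definition cts f := forall i, continuous (f i).

Definition uclose f g (e : R) := forall i x, `|f i x - g i x| <= e.

(* Openness and density in C(K)^nat with the uniform metric; maps to R^n are
   handled through their first [n] coordinates. *)
Definition gopen (P : (nat -> K -> R) -> Prop) := forall f, cts f -> P f ->
  exists2 d, 0 < d & forall g, cts g -> uclose g f d -> P g.

Definition gdense (P : (nat -> K -> R) -> Prop) := forall f e, cts f -> 0 < e ->
  exists g, [/\ cts g, uclose g f e & P g].

Lemma uclose_trans f g h a b c :
  uclose f g a -> uclose g h b -> a + b <= c -> uclose f h c.
Proof.
move=> fg gh abc i x; rewrite (le_trans (ler_distD (g i x) _ _))//.
by rewrite (le_trans _ abc)// lerD.
Qed.

Lemma ucloseW f g a b : uclose f g a -> a <= b -> uclose f g b.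
Proof. by move=> fg ab i x; exact: le_trans ab. Qed.

Lemma gdenseI P Q : gopen P -> gdense P -> gdense Q -> gdense (fun f => P f /\ Q f).
Proof.
move=> oP dP dQ f e cf e0.
have [g [cg gf /(oP _ cg)[d d0 gP]]] := dP f (e / 2) cf ltac:(by rewrite divr_gt0).
have de0 : 0 < Num.min d (e / 2) by rewrite lt_min d0 divr_gt0.
have [h [ch hg Qh]] := dQ g _ cg de0.
exists h; split=> //.
  apply: uclose_trans hg gf _; rewrite [leRHS]splitr lerD2r.
  by rewrite ge_min lexx orbT.
split=> //; apply: gP => //; apply: ucloseW hg _.
by rewrite ge_min lexx.
Qed.

(** Baire's argument carried out directly: nested uniform balls, the radius at least halved each
    time and the ball of stage [m.+1] inside [P m]; the limit of the centers lies in all of them. *)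
Lemma gdense_baire (P : nat -> (nat -> K -> R) -> Prop) :
    (forall m, gopen (P m)) -> (forall m, gdense (P m)) ->
  gdense (fun f => forall m, P m f).
Proof.
move=> oP dP f e cf e0.
pose good (st : (nat -> K -> R) * R) := cts st.1 /\ 0 < st.2.
pose next m (st st' : (nat -> K -> R) * R) := [/\ uclose st'.1 st.1 (st.2 / 2),
  st'.2 <= st.2 / 2 & forall h, cts h -> uclose h st'.1 st'.2 -> P m h].
have [S HS] : {S : nat -> (nat -> K -> R) * R -> (nat -> K -> R) * R |
    forall m st, good st -> good (S m st) /\ next m st (S m st)}.
  apply/cid; pose T : Type := (nat * ((nat -> K -> R) * R))%type.
  have /choice[S HS] : forall mst : T, exists st', good mst.2 ->
      good st' /\ next mst.1 mst.2 st'.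
    move=> [m st] /=; have [[cst st0]|nst] := pselect (good st); last first.
      by exists st => /nst.
    have [g [cg gf /(oP m _ cg)[d d0 gP]]] :=
      dP m st.1 (st.2 / 2) cst ltac:(by rewrite divr_gt0).
    exists (g, Num.min d (st.2 / 2)) => _; split.
      by split=> //=; rewrite lt_min d0 divr_gt0.
    split=> //=; first by rewrite ge_min lexx orbT.
    by move=> h ch hg; apply: gP => //; apply: ucloseW hg _; rewrite ge_min lexx.
  by exists (fun m st => S (m, st)) => m st /(HS (m, st)).
pose fix st m := if m is m'.+1 then S m' (st m') else (f, e).
have gst m : good (st m) by elim: m => [|m IH] //=; apply (HS m _ IH).1.
have nst m : next m (st m) (st m.+1) by exact: (HS m _ (gst m)).2.
pose F m := (st m).1; pose r m := (st m).2.
have r0 m : 0 < r m by case: (gst m).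
have FF m k i x : (m <= k)%N -> `|F k i x - F m i x| <= r m - r k.
  move=> /subnK <-; elim: (k - m)%N => [|j IH].
    by rewrite add0n !subrr normr0.
  rewrite addSn; have [H1 H2 _] := nst (j + m)%N.
  rewrite (le_trans (ler_distD (F (j + m)%N i x) _ _))//.
  have := H1 i x; rewrite -/(F (j + m)%N) -/(F (j + m).+1) -/(r _) => h1.
  have : r (j + m).+1 <= r (j + m)%N / 2 by [].
  by move=> ?; lra.
(* The limit is taken as a supremum: by [FF] the lower bounds [F m i x - r m] increase with [m] and
   stay below every [F m i x + r m]. *)
pose G i x := sup [set F m i x - r m | m in setT].
have Gub i x m : ubound [set F m i x - r m | m in setT] (F m i x + r m).
  move=> _ [k _ <-]; have [mk|/ltnW km] := leqP m k.
    have := FF _ _ i x mk; rewrite ler_distl => /andP[? ?].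
    by have := r0 k; lra.
  have := FF _ _ i x km; rewrite ler_distl => /andP[? ?].
  by have := r0 m; lra.
have GF m : uclose G (F m) (r m).
  move=> i x; rewrite ler_distl; apply/andP; split.
    by apply: ub_le_sup; [exists (F m i x + r m); exact: Gub|exists m].
  by apply: ge_sup; [exists (F m i x - r m); exists m|exact: Gub].
have r_small d : 0 < d -> exists m, r m < d.
  move=> d0; pose m := Num.Def.archi_bound (e / d); exists m.
  have re k : r k <= e / 2 ^+ k.
    elim: k => [|k IH]; first by rewrite expr0 divr1.
    have [_ H _] := nst k; rewrite (le_trans H)// exprSr invfM mulrA.
    by rewrite ler_pM2r.
  rewrite (le_lt_trans (re m))// ltr_pdivrMr ?exprn_gt0// mulrC -ltr_pdivrMr//.
  exact: upper_nthrootP.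
have cG : cts G.
  move=> i; apply/continuous_distP => x d d0; have d3 : 0 < d / 3 by rewrite divr_gt0.
  have [m rm] := r_small _ d3.
  have /continuous_distP/(_ x _ d3) := (gst m).1 i.
  apply: filterS => z /= xz.
  have := GF m i x; have := GF m i z; move: xz; rewrite -/(F m).
  rewrite !ltr_distl !ler_distl => /andP[? ?] /andP[? ?] /andP[? ?].
  by apply/andP; split; lra.
exists G; split=> // [|m]; first exact: (GF 0).
by have [_ _] := nst m; apply=> //; exact: (GF m.+1).
Qed.

End sequences_of_functions.

(** * Fibers *)

Section fibers.
Context {R : realType} {K : metricType R}.
Hypothesis cK : compact [set: K].
Implicit Types (f g : nat -> K -> R) (y : nat -> R) (C N O : set K) (s e : R).

Definition fib n f y (r : R) : set K :=
  [set z | forall i, (i < n)%N -> `|f i z - y i| <= r].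

Lemma fib_uclose n f g y a b c : uclose g f a -> b + a <= c ->
  fib n g y b `<=` fib n f y c.
Proof.
move=> fg bac z gz i i_n; have := gz _ i_n; have := fg i z.
by rewrite !ler_distl => /andP[? ?] /andP[? ?]; apply/andP; split; lra.
Qed.

(** At a point off the exact fiber some coordinate differs from [y] by a positive amount, and by
    half of it nearby; compactness of [C] makes the tolerance uniform. *)
Lemma fib_thick1 n f y C O : cts f -> compact C -> open O ->
    C `&` fib n f y 0 `<=` O ->
  exists2 r, 0 < r & C `&` fib n f y r `<=` O.
Proof.
move=> cf /compact_near_coveringP cC oO H.
have : \forall r \near 0^'+, C `<=` [set z | fib n f y r z -> O z].
  apply: cC => x Cx; have [fx|nfx] := pselect (fib n f y 0 x).
    exists (O, setT); first split=> //=; last by move=> [z r] /= [].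
      by apply: open_nbhs_nbhs; split=> //; exact: H.
    exact: filterT.
  have [i [i_n fi]] : exists i, (i < n)%N /\ 0 < `|f i x - y i|.
    apply: contrapT => Hn; apply: nfx => i i_n; rewrite leNgt; apply/negP => fi.
    by apply: Hn; exists i.
  have d0 : 0 < `|f i x - y i| / 2 by rewrite divr_gt0.
  have /continuous_distP/(_ x _ d0) cfi := cf i.
  exists ([set z | `|f i x - f i z| < `|f i x - y i| / 2],
          [set r | r < `|f i x - y i| / 2]).
    by split=> //=; exact: nbhs_right_lt.
  move=> [z r] /= [xz rd] /(_ _ i_n) zr; exfalso.
  by have := ler_distD (f i z) (f i x) (y i); lra.
move=> Hr; near (0 : R)^'+ => r; exists r => //.
by move=> z [Cz fz]; apply: (near Hr r).
Unshelve. all: by end_near. Qed.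

(** By [fib_thick1] a cover of an exact fiber also covers a thickened one. Compactness of [K]
    reduces to finitely many values of [f], hence to one tolerance and one neighborhood. *)
Lemma fib_thick n s e C f : cts f -> compact C -> 0 <= e ->
    (forall y, scover s e (C `&` fib n f y 0)) ->
  exists r N, [/\ 0 < r, open N, C `<=` N &
    forall y, scover s e (N `&` fib n f y r)].
Proof.
move=> cf cC e0 H.
have /choice[Or HO] : forall x, exists Or : seq (K * R) * R,
    [/\ 0 < Or.2, scover s e (balls Or.1) &
      C `&` fib n f (f ^~ x) Or.2 `<=` balls Or.1].
  move=> x; have [l [Cl sl]] := scover_balls (H (f ^~ x)).
  have [r r0 rP] := fib_thick1 cf cC (open_balls l) Cl.
  by exists (l, r).
pose r x := (Or x).2; pose O x := balls (Or x).1.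
have r0 x : 0 < r x by case: (HO x).
have [|l lP] := @compact_seq_cover K K setT
   (fun x => [set z | forall i, (i < n)%N -> `|f i x - f i z| < r x / 2]) cK.
  move=> x _; exists x; apply: nbhs_nat_forall => i _.
  by have /continuous_distP := cf i; apply; rewrite divr_gt0.
have [d d0 dr] := seq_lower_bound l r0.
(* If the thickened fiber over [y] meets [N] at [z0], then [z0] is close to some [x] in [l]. The
   errors [d / 4], [d / 4] and [r x / 2] sum to at most [r x], so this fiber lies in [O x] within
   [N]. *)
pose N := [set z | forall x, x \in l -> (O x `|` ~` fib n f (f ^~ x) (r x)) z].
exists (d / 4), N; split=> //.
- by rewrite divr_gt0.
- apply: open_seq_forall => x; apply: openU; first exact: open_balls.
  rewrite openE => z nfz; have [i [i_n fi]] : exists i, (i < n)%N /\ r x < `|f i z - f i x|.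
    apply: contrapT => Hn; apply: nfz => i i_n; rewrite leNgt; apply/negP => fi.
    by apply: Hn; exists i.
  have /continuous_distP/(_ z (`|f i z - f i x| - r x)) := cf i.
  rewrite subr_gt0 => /(_ fi); apply: filterS => t /= zt /(_ _ i_n) tr.
  by have := ler_distD (f i t) (f i z) (f i x); lra.
- move=> z Cz x xl; have [fz|] := pselect (fib n f (f ^~ x) (r x) z); last by right.
  by left; have [_ _] := HO x; apply.
- move=> y; have [[z0 [Nz0 fz0]]|N0] := pselect ((N `&` fib n f y (d / 4)) !=set0).
    have [x xl xz0] := lP z0 I; have [_ sO _] := HO x.
    apply: scoverS sO => z [Nz fz]; case: (Nz _ xl) => // -[] i i_n.
    have := fz _ i_n; have := fz0 _ i_n; have := xz0 _ i_n; have := dr _ xl.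
    rewrite ltr_distl !ler_distl => ? /andP[? ?] /andP[? ?] /andP[? ?].
    by apply/andP; split; lra.
  suff -> : N `&` fib n f y (d / 4) = set0 by exact: scover0.
  by rewrite -subset0 => z Hz; apply: N0; exists z.
Qed.

(** Null up to the tolerance [e]. The lower bound works with the fiber over 0 alone, the upper bound
    with all fibers at once. *)
Definition null_fiber n s e C f := scover s e (C `&` fib n f (fun=> 0) 0).

Definition null_fibers n s e C f := forall y, scover s e (C `&` fib n f y 0).

Lemma gopen_null_fiber n s e C : compact C -> gopen (null_fiber n s e C).
Proof.
move=> cC f cf /scover_balls[l [Cl sl]].
have [r r0 rP] := fib_thick1 cf cC (open_balls l) Cl.
exists r => // g cg gf; apply: scoverS sl.
move=> z [Cz gz]; apply: rP; split=> //.
by apply: (fib_uclose gf _ gz); rewrite add0r.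
Qed.

Lemma gopen_null_fibers n s e C : compact C -> 0 <= e -> gopen (null_fibers n s e C).
Proof.
move=> cC e0 f cf /(fib_thick cf cC e0)[r [N [r0 _ CN H]]].
exists r => // g cg gf y; apply: scoverS (H y) => z [Cz gz]; split; first exact: CN.
by apply: (fib_uclose gf _ gz); rewrite add0r.
Qed.

Lemma gdense_null_fibersU n s e1 e2 C1 C2 : compact C1 -> 0 <= e1 -> 0 <= e2 ->
  gdense (null_fibers n s e1 C1) -> gdense (null_fibers n s e2 C2) ->
  gdense (null_fibers n s (e1 + e2) (C1 `|` C2)).
Proof.
move=> cC1 e10 e20 d1 d2 f e cf e0.
have [g [cg gf [g1 g2]]] := gdenseI (gopen_null_fibers cC1 e10) d1 d2 cf e0.
by exists g; split=> // y; rewrite setIUl; exact: scoverU.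
Qed.

Lemma gdense_null_fiberU n s e1 e2 C1 C2 : compact C1 -> 0 <= e1 -> 0 <= e2 ->
  gdense (null_fiber n s e1 C1) -> gdense (null_fiber n s e2 C2) ->
  gdense (null_fiber n s (e1 + e2) (C1 `|` C2)).
Proof.
move=> cC1 e10 e20 d1 d2 f e cf e0.
have [g [cg gf [g1 g2]]] := gdenseI (gopen_null_fiber cC1) d1 d2 cf e0.
by exists g; split=> //; rewrite /null_fiber setIUl; exact: scoverU.
Qed.

End fibers.

(** * Negligible sets *)

(** The radii are at most [e <= 1], so a larger exponent makes their powers smaller. *)
Lemma scover_mono (R : realType) (K : metricType R) (E : set K) (s s' e e' : R) :
  s <= s' -> e <= e' -> e <= 1 -> scover s e E -> scover s' e' E.
Proof.
move=> ss' ee' e1 [l [/allP l1 l2 l3]]; exists l; split=> //.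
  by apply/allP => p /l1/andP[-> /=] /le_trans; exact.
rewrite (le_trans _ ee')// (le_trans _ l2)//.
rewrite big_seq [leRHS]big_seq; apply: ler_sum => p /l1/andP[p0 pe].
rewrite -(subrK s s') powRD ?(gt_eqF p0) ?implybT// ler_piMl ?powR_ge0//.
have -> : 1 = 1 `^ (s' - s) :> R by rewrite powR1.
rewrite ge0_ler_powR ?nnegrE ?subr_ge0// ?(ltW p0)//.
by rewrite (le_trans pe).
Qed.

Lemma gdense_baire_count (R : realType) (K : topologicalType) (T : countType)
    (P : T -> (nat -> K -> R) -> Prop) :
    (forall t, gopen (P t)) -> (forall t, gdense (P t)) ->
  gdense (fun f => forall t, P t f).
Proof.
move=> oP dP f e cf e0.
pose Q m := if unpickle m is Some t then P t else fun=> True.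
have [||g [cg gf Qg]] := @gdense_baire _ _ Q _ _ f e cf e0.
- rewrite /Q => m; case: unpickle => [t|]; first exact: oP.
  by move=> h _ _; exists 1.
- rewrite /Q => m; case: unpickle => [t|]; first exact: dP.
  by move=> h d ch d0; exists h; split=> // i x; rewrite subrr normr0 ltW.
by exists g; split=> // t; have := Qg (pickle t); rewrite /Q pickleK.
Qed.

Lemma notin_seq_exists (T : eqType) (u : nat -> T) (l : seq T) :
  injective u -> exists k, u k \notin l.
Proof.
move=> inju; apply: contrapT => Hn.
have : (size (map u (iota 0 (size l).+1)) <= size l)%N.
  apply: uniq_leq_size; first by rewrite map_inj_uniq// iota_uniq.
  move=> _ /mapP[k _ ->]; apply: contrapT => /negP kl.
  by apply: Hn; exists k.
by rewrite size_map size_iota ltnn.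
Qed.

Lemma natr_inv_small (R : realType) (d : R) : 0 < d -> exists k : nat, k.+1%:R^-1 < d.
Proof.
move=> d0; exists (Num.truncn d^-1).
by rewrite -[ltRHS]invrK ltf_pV2 ?posrE ?invr_gt0// truncnS_gt.
Qed.

Lemma isometry_continuous (R : realType) (X K : metricType R) (phi : X -> K) :
  (forall x y, mdist (phi x) (phi y) = mdist x y) -> continuous phi.
Proof.
move=> iso x A /nbhs_mdist[r r0 rA]; apply/nbhs_mdist; exists r => // y xy.
by apply: rA; rewrite iso.
Qed.

Lemma mdist_continuous (R : realType) (X : metricType R) (c : X) :
  continuous (fun x => mdist c x).
Proof.
apply/continuous_distP => x e e0; apply/nbhs_mdist; exists e => // y xy.
rewrite /= ltr_distl; have := metric_triangle c x y; have := metric_triangle c y x.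
by rewrite (metric_sym y x) => ? ?; apply/andP; split; lra.
Qed.

Section lower_bound.
Context {R : realType} {K : metricType R}.
Hypothesis cK : compact [set: K].
Implicit Types (f g : nat -> K -> R) (C : set K) (s e : R).

(** Tolerances [e] in place of exact null sets make each condition open for compact [C], as the
    Baire argument requires; exponents range strictly above [s], as in a bound on Hausdorff
    dimension. *)
Definition negligible n s C :=
  forall s' e, s < s' -> 0 < e -> gdense (null_fiber n s' e C).

Lemma compact_net (x0 : K) (r : R) : 0 < r ->
  exists q : nat -> K, forall x, exists j, mdist (q j) x < r.
Proof.
move=> r0; have [|l lP] := @compact_seq_cover K K setT (fun c => [set x | mdist c x < r]) cK.
  move=> x _; exists x; apply/nbhs_mdist; exists r => //.
exists (nth x0 l) => x; have [c cl cx] := lP x I.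
by exists (index c l); rewrite nth_index.
Qed.

(** Rescaled distances to the points of a finite net at every scale. The third index repeats each
    function infinitely often, so finite lists can be avoided. The gap between -1/2 and 1/2 leaves
    room for a later perturbation by 1/4. *)
Lemma separating_functions : exists h : nat -> K -> R, cts h /\
  forall (l : seq nat) x r, 0 < r -> exists2 i, i \notin l &
    h i x < - 2^-1 /\ forall z, h i z <= 2^-1 -> mdist x z < r.
Proof.
have [[x0 _]|K0] := pselect ([set: K] !=set0); last first.
  exists (fun=> fun=> 0); split=> [i|l x]; first exact: cst_continuous.
  by case: K0; exists x.
have /choice[q qP] : forall m : nat, exists q : nat -> K,
    forall x, exists j, mdist (q j) x < (2 * m.+1%:R)^-1.
  by move=> m; apply: compact_net => //; rewrite invr_gt0 mulr_gt0.
pose w (t : nat * nat * nat) x : R := t.1.1.+1%:R * mdist (q t.1.1 t.1.2) x - 1.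
pose h i := if unpickle i is Some t then w t else fun=> 0.
exists h; split=> [i|l x r r0].
  rewrite /h; case: unpickle => [t|]; last exact: cst_continuous.
  move=> x; apply: cvgB; last exact: cvg_cst.
  by apply: cvgM; [exact: cvg_cst|exact: mdist_continuous].
(* After scaling by [m.+1], the net point is within 1/2 of [x] and 3/2 of [z], together less than 2,
   while [r] becomes more than 3. *)
have [m mr] := natr_inv_small (divr_gt0 r0 (ltr0Sn R 2)).
have [j qx] := qP m x.
have [|t tl] := @notin_seq_exists _ (fun t => pickle (m, j, t)) l.
  by move=> t1 t2 /(pcan_inj (@pickleK _)) [].
exists (pickle (m, j, t)) => //; rewrite /h pickleK /w /=.
have m0 : 0 < m.+1%:R :> R by [].
have mx : m.+1%:R * mdist (q m j) x < 2^-1.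
  by rewrite mulrC -ltr_pdivlMr// -invfM.
split; first by lra.
move=> z hz; apply: le_lt_trans (metric_triangle _ (q m j) _) _.
rewrite (metric_sym x) -(ltr_pM2l m0).
have : 1 < m.+1%:R * (r / 3) by rewrite mulrC -ltr_pdivrMr// div1r.
by rewrite mulrDr; lra.
Qed.

(* Avoiding a finite list [l] makes room for a new index at each step of the
   induction on the dimension. *)
Lemma negligible_family n s C : compact C -> negligible n s C ->
  exists g, [/\ cts g,
    forall (l : seq nat) x r, 0 < r -> exists2 i, i \notin l &
      g i x < 0 /\ forall z, g i z < 0 -> mdist x z < r &
    forall (l : seq nat) k, size l = n -> uniq l ->
      scover (s + k.+1%:R^-1) k.+1%:R^-1
        (C `&` [set z | forall i, i \in l -> g i z = 0])].
Proof.
move=> cC sC; have [h [ch hP]] := separating_functions.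
pose P (t : seq nat * nat) g := size t.1 = n -> uniq t.1 ->
  null_fiber n (s + t.2.+1%:R^-1) t.2.+1%:R^-1 C (fun i => g (nth 0 t.1 i)).
have [|||g [cg gh Pg]] := @gdense_baire_count R K _ P _ _ h 4^-1 ch.
- move=> [l k] f cf /=; rewrite /P /=.
  have [[sl ul]|nl] := pselect (size l = n /\ uniq l); last first.
    by exists 1 => // g _ _ sl ul; case: nl.
  have cf' : cts (fun i => f (nth 0 l i)) by move=> i; exact: cf.
  move=> /(_ sl ul)/(gopen_null_fiber cC cf')[d d0 dP].
  exists d => // g cg gf _ _; apply: dP => [i|i x]; [exact: cg|exact: gf].
- move=> [l k] f e cf e0 /=; rewrite /P /=.
  have [[sl ul]|nl] := pselect (size l = n /\ uniq l); last first.
    exists f; split=> //; first by move=> i x; rewrite subrr normr0 ltW.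
    by move=> sl ul; case: nl.
  have cf' : cts (fun i => f (nth 0 l i)) by move=> i; exact: cf.
  have [||g [cg gf Pg]] := sC (s + k.+1%:R^-1) k.+1%:R^-1 _ _ _ _ cf' e0.
  + by rewrite ltrDl invr_gt0.
  + by rewrite invr_gt0.
  (* The perturbed functions are written back at the positions in [l], consistently because [l] has
     no repetitions. *)
  exists (fun j => if j \in l then g (index j l) else f j); split.
  + by move=> j; case: ifP => _; [exact: cg|exact: cf].
  + move=> j x; case: ifP => jl; last by rewrite subrr normr0 ltW.
    by have := gf (index j l) x; rewrite nth_index.
  + move=> _ _; apply: scoverS Pg => z [Cz fz]; split=> // i i_n.
    by have := fz i i_n; rewrite mem_nth ?sl// index_uniq ?sl.
- by rewrite invr_gt0.
exists g; split=> // [l x r r0|l k sl ul].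
  have [i il [hx hz]] := hP l x r r0; exists i => //.
  have := gh i x; rewrite ler_distl => /andP[? ?]; split; first lra.
  move=> z gz; apply: hz; have := gh i z; rewrite ler_distl => /andP[? ?]; lra.
apply: scoverS (Pg (l, k) sl ul) => z [Cz gz]; split=> // i i_n.
by rewrite gz ?subrr ?normr0// mem_nth// sl.
Qed.

(** The boundary of [g i < 0] lies in the zero set of [g i]. After [n] boundaries with distinct
    indices the space lies in a common zero set of [n] functions, of Hausdorff dimension at most
    [s]. *)
Lemma ind_hausdorff_dim_le_negligible n s C (X : metricType R) (phi : X -> K) :
    compact C -> 0 <= s -> negligible n s C ->
    (forall x y, mdist (phi x) (phi y) = mdist x y) -> range phi `<=` C ->
  (ind_hausdorff_dim n X <= (s + n%:R)%:E)%E.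
Proof.
move=> cC s0 sC; have [g [cg gB gl]] := negligible_family cC sC.
(* [l] records the functions that vanish on the current space, [m] the number of boundaries still to
   be taken. *)
suff H m l : (size l + m)%N = n -> uniq l ->
    forall (Y : metricType R) (psi : Y -> K),
    (forall x y, mdist (psi x) (psi y) = mdist x y) ->
    (forall x, C (psi x) /\ forall i, i \in l -> g i (psi x) = 0) ->
    (ind_hausdorff_dim m Y <= (s + m%:R)%:E)%E.
  move=> iso phiC; apply: (H n [::] (add0n _) isT X phi iso) => x; split=> //.
  by apply: phiC; exists x.
elim: m l => [|m IH] l ln ul Y psi iso psiC /=.
  rewrite addr0; case: ifP => _.
    by rewrite lee_fin (le_trans _ s0)// lerN10.
  apply: (hausdorff_dim_le iso) => // s' e ss' e0.
  have d0 : 0 < Num.min (s' - s) e by rewrite lt_min subr_gt0 ss'.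
  have [k] := natr_inv_small d0; rewrite lt_min => /andP[k1 k2].
  rewrite addn0 in ln; apply: scover_mono (scoverS _ (gl l k ln ul)).
  - by rewrite -lerBrDl ltW.
  - exact: ltW.
  - by rewrite invf_le1// ler1n.
  - by move=> _ [x _ <-]; exact: psiC.
case: ifP => _.
  by rewrite lee_fin (le_trans _ (addr_ge0 s0 (ler0n _ _)))// lerN10.
have cgp i : continuous (g i \o psi).
  move=> x; apply: continuous_comp; last exact: cg.
  exact: isometry_continuous.
apply: ereal_inf_lbound.
exists [set U | exists2 i, i \notin l & U = [set x | g i (psi x) < 0]].
  split.
    move=> _ [i il ->]; rewrite (_ : [set x | _] = (g i \o psi) @^-1` [set y | y < 0])//.
    by apply: open_comp; [move=> x _; exact: cgp|exact: open_lt].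
  move=> x V /nbhs_mdist[r r0 rV].
  have [i il [gx gz]] := gB l (psi x) r r0.
  exists [set z | g i (psi z) < 0]; first by split=> //; exists i.
  by move=> z /gz; rewrite iso; exact: rV.
move=> _ [i il ->]; set U := [set x | _].
have oU : open U.
  rewrite (_ : U = (g i \o psi) @^-1` [set y | y < 0])//.
  by apply: open_comp; [move=> x _; exact: cgp|exact: open_lt].
rewrite -EFinB -natr1 addrA addrK.
apply: (IH (i :: l) _ _ _ (psi \o set_val)) => /=.
- by rewrite addSnnS.
- by rewrite il.
- by move=> x y; exact: iso.
- move=> x; have [Cx lx] := psiC (set_val x); split=> // j.
  rewrite inE => /predU1P[->|]; last exact: lx.
  have [clx nx] := set_valP x; apply/eqP; rewrite eq_le; apply/andP; split.
    have : closed [set z | g i (psi z) <= 0] by exact: (closed_sublevel (cgp i)).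
    rewrite closure_id => cl; have : closure [set z | g i (psi z) <= 0] (set_val x).
      by apply: closure_subset clx => z /ltW.
    by rewrite -cl.
  by rewrite leNgt; apply/negP => gx; apply: nx; rewrite (interior_id _).1.
Qed.

End lower_bound.

(** * Generic fibers are small *)

Lemma compact_set_type (R : realType) (X : metricType R) (A : set X) :
  compact A -> compact [set: A].
Proof.
move=> cA F FF _.
have [|p [Ap Fp]] := cA (set_val @ F) _ _.
  by apply: (@filterS _ F _ setT) => [x _|]; [exact: set_valP|exact: filterT].
exists (exist _ p (mem_set Ap)); split=> // P V FP /nbhs_mdist[r r0 rV].
have FP' : F (set_val @^-1` (set_val @` P)) by apply: filterS FP => x Px; exists x.
have pr : nbhs p [set q | mdist p q < r] by apply/nbhs_mdist; exists r.
have [_ [[x Px <-] px]] := Fp _ _ FP' pr.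
by exists x; split=> //; exact: rV.
Qed.

Section clip.
Context {R : realType}.
Implicit Types (e t u : R).

(* Truncation keeps a perturbation within [e] without changing it where it is
   already small. *)
Definition clip e t := Num.max (- e) (Num.min e t).

Lemma clip_norm e t : 0 <= e -> `|clip e t| <= e.
Proof.
move=> e0; rewrite ler_norml /clip le_max lexx/= ge_max ge_min lexx/= andbT.
by rewrite (le_trans _ e0)// oppr_le0.
Qed.

Lemma clip_id e t : `|t| <= e -> clip e t = t.
Proof.
rewrite ler_norml => /andP[e1 e2]; rewrite /clip.
by rewrite (min_r e2) (max_r e1).
Qed.

Lemma clip_lip e t u : 0 <= e -> `|clip e t - clip e u| <= `|t - u|.
Proof.
move=> e0; have := ler_norm (t - u); have := ler_norm (u - t); rewrite distrC.
move: `|t - u| => d dut dtu; rewrite /clip ler_norml.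
case: (leP e t) => ?; case: (leP e u) => ?; case: (leP (- e) e) => ?;
  try case: (leP (- e) t) => ?; try case: (leP (- e) u) => ?;
  by apply/andP; split; lra.
Qed.

Lemma clip_continuous (T : topologicalType) e (f : T -> R) : 0 <= e ->
  continuous f -> continuous (fun x => clip e (f x)).
Proof.
move=> e0 /continuous_distP cf; apply/continuous_distP => x d d0.
by apply: filterS (cf x d d0) => z; apply: le_lt_trans; exact: clip_lip.
Qed.

End clip.

(** Induction on [m]: a Urysohn function moves [g] to a fresh constant on [Z m] and leaves it alone
    on the earlier sets. Clipping the difference from [f] keeps the error at [e] throughout, so
    errors do not accumulate. *)
Lemma separating_constants (R : realType) (K : metricType R) (m : nat)
    (Z : nat -> set K) (f : K -> R) (e : R) :
    0 < e -> continuous f -> (forall i, closed (Z i)) ->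
    (forall i j, (j < i)%N -> Z i `&` Z j = set0) ->
    (forall i, exists v, forall z, Z i z -> `|f z - v| <= e / 2) ->
  exists g c, [/\ continuous g, forall z, `|g z - f z| <= e,
    forall i j, (i < m)%N -> (j < m)%N -> c i = c j -> i = j &
    forall i z, (i < m)%N -> Z i z -> g z = c i].
Proof.
move=> e0 cf cZ dZ fZ; elim: m => [|m [g [c [cg gf injc gc]]]].
  by exists f, (fun=> 0); split=> // z; rewrite subrr normr0 ltW.
have [v vP] := fZ m.
(* Infinitely many candidates lie within [e / 2] of [v], so one differs from all earlier constants;
   with the oscillation [e / 2] of [f] it is within [e] of [f] on [Z m]. *)
have [|k kP] := @notin_seq_exists _ (fun k : nat => v + e / 2 / k.+1%:R) (map c (iota 0 m)).
  move=> k k' /addrI/mulfI; rewrite gt_eqF ?divr_gt0// => /(_ isT)/invr_inj/eqP.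
  by rewrite eqr_nat => /eqP[].
pose w := v + e / 2 / k.+1%:R.
have wc i : (i < m)%N -> w != c i.
  move=> im; apply: contraNneq kP; rewrite -/w => ->.
  by apply/mapP; exists i => //; rewrite mem_iota.
have wf z : Z m z -> `|w - f z| <= e.
  move=> /vP; rewrite !ler_distl => /andP[? ?].
  have : e / 2 / k.+1%:R <= e / 2.
    by rewrite ler_pdivrMr// ler_peMr ?ler1n// divr_ge0// ltW.
  have : 0 <= e / 2 / k.+1%:R by rewrite !divr_ge0// ltW.
  rewrite /w; move: (e / 2 / k.+1%:R) => q ? ?.
  by apply/andP; split; lra.
pose Y := \big[setU/set0]_(i < m) Z i.
have YP z : Y z <-> exists2 i, (i < m)%N & Z i z.
  rewrite /Y -bigcup_mkord; split=> [[i /= im Zi]|[i im Zi]]; exists i => //.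
have [psi [cpsi psi0 psi1 _]] : exists psi : K -> R, [/\ continuous psi,
    psi @` Y `<=` [set 0], psi @` (Z m) `<=` [set 1] & range psi `<=` `[0, 1]].
  apply: urysohn_ext_itv => //; first exact: pseudometric_normal.
    by rewrite /Y -bigcup_mkord; apply: closed_bigcup => //; exact: finite_II.
  rewrite -subset0 => z [/YP[i im Zi] Zm].
  by have := dZ _ _ im; rewrite -subset0 => /(_ z); apply.
exists (fun z => f z + clip e (g z - f z + psi z * (w - g z))).
exists (fun i => if i == m then w else c i); split.
- have cu : continuous (fun z => g z - f z + psi z * (w - g z)).
    move=> z; apply: cvgD; first by apply: cvgB; [exact: cg|exact: cf].
    by apply: cvgM; [exact: cpsi|apply: cvgB; [exact: cvg_cst|exact: cg]].
  move=> z; apply: cvgD; first exact: cf.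
  exact: (clip_continuous (ltW e0) cu).
- by move=> z; rewrite addrAC subrr add0r clip_norm// ltW.
- move=> i j; rewrite !ltnS; case: eqP => [->|/eqP im]; case: eqP => [->//|/eqP jm].
  + by move=> _ jle /eqP; rewrite (negbTE (wc _ _))// ltn_neqAle jm.
  + by move=> ile _ /esym/eqP; rewrite (negbTE (wc _ _))// ltn_neqAle im.
  + by move=> ile jle; apply: injc; rewrite ltn_neqAle ?im ?jm.
- move=> i z; rewrite ltnS; case: eqP => [->|/eqP im].
    move=> _ Zz; have -> : psi z = 1 by apply: psi1; exists z.
    have -> : g z - f z + 1 * (w - g z) = w - f z by ring.
    by rewrite clip_id ?wf// addrC subrK.
  move=> ile Zz; have im' : (i < m)%N by rewrite ltn_neqAle im.
  have -> : psi z = 0 by apply: psi0; exists z => //; apply/YP; exists i.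
  by rewrite mul0r addr0 clip_id ?gf// addrC subrK; exact: gc.
Qed.

Section upper_bound.
Context {R : realType} {K : metricType R}.
Hypothesis cK : compact [set: K].
Implicit Types (f g : nat -> K -> R) (C : set K) (s e : R).

Lemma gdense_null_fibers_bigU n s (I : Type) (l : seq I) (C : I -> set K) :
    (forall i, compact (C i)) ->
    (forall i e, 0 < e -> gdense (null_fibers n s e (C i))) ->
  forall e, 0 < e -> gdense (null_fibers n s e (\big[setU/set0]_(i <- l) C i)).
Proof.
move=> cC H; elim: l => [|i l IH] e e0.
  rewrite big_nil => f d cf d0; exists f; split=> //.
    by move=> i x; rewrite subrr normr0 ltW.
  by move=> y; rewrite set0I; exact/scover0/ltW.
have e2 : 0 < e / 2 by rewrite divr_gt0.
rewrite big_cons [e]splitr; apply: gdense_null_fibersU => //; try exact: ltW.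
- exact: H.
- exact: IH.
Qed.

(** In the induction step the first [n] coordinates are perturbed by the induction hypothesis on
    boundaries, and coordinate [n] is perturbed by [separating_constants]. *)
Lemma gdense_null_fibers_ind n s (X : metricType R) (phi : X -> K) :
    0 < s -> compact [set: X] ->
    (forall x y, mdist (phi x) (phi y) = mdist x y) ->
    (ind_hausdorff_dim n X < (s + n%:R)%:E)%E ->
  forall e, 0 < e -> gdense (null_fibers n s e (range phi)).
Proof.
move=> s0; elim: n X phi => [|n IH] X phi cX iso /=.
  rewrite addr0 => sX e e0 f d cf d0; exists f; split=> //.
    by move=> i x; rewrite subrr normr0 ltW.
  move=> y; apply: (@scoverS _ _ _ _ _ (range phi)) => [z []//|].
  case: ifP sX => [/eqP -> _|_ sX]; first by rewrite image_set0; exact/scover0/ltW.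
  apply: (scover_hausdorff_dim iso) => //; apply: continuous_compact => //.
  by apply: continuous_subspaceT; exact: isometry_continuous.
case: ifP => [/eqP X0 _ e e0 f d cf d0|/negbT/set0P[x0 _]].
  exists f; split=> //; first by move=> i x; rewrite subrr normr0 ltW.
  by move=> y; rewrite X0 image_set0 set0I; exact/scover0/ltW.
move=> /ereal_inf_lt[d [B bB HB] dsn] e e0 f eta cf eta0.
have {}HB : forall W, B W -> (ind_hausdorff_dim n (boundary W) < (s + n%:R)%:E)%E.
  move=> W /HB/le_lt_trans; apply; case: d dsn {HB} => [d| |].
  - by rewrite -EFinB !lte_fin -natr1 addrA ltrBlDr.
  - by [].
  - by rewrite addNye => _; exact: ltNyr.
have cphi := isometry_continuous iso.
have injphi x y : phi x = phi y -> x = y.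
  by move=> xy; apply: mdist_positivity; rewrite -iso xy mdistxx.
have e2 : 0 < e / 2 by rewrite divr_gt0.
(* Each closure alone costs at most [e / 2], enough for the single piece that a fiber meets off [N].
   The small oscillation of [f n] allows a constant value on each piece. *)
have /choice[U UP] : forall x : X, exists U : set X, [/\ B U, U x,
    forall z, closure U z -> `|f n (phi z) - f n (phi x)| <= eta / 2 &
    scover s (e / 2) (phi @` closure U)].
  move=> x; have [r r0 sr] := scover_ball (phi x) s0 e2.
  have eta2 : 0 < eta / 2 by rewrite divr_gt0.
  pose V := [set z | mdist x z < r / 2 /\ `|f n (phi x) - f n (phi z)| < eta / 2].
  have Vx : nbhs x V.
    apply: filterI; first by apply/nbhs_mdist; exists (r / 2); rewrite ?divr_gt0.
    have /continuous_distP/(_ x _ eta2) // : continuous (f n \o phi).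
    by move=> z; apply: continuous_comp; [exact: cphi|exact: cf].
  have [_ /(_ x V Vx)[W [BW Wx] WV]] := bB.
  have cW1 : closure W `<=` [set z | mdist x z <= r / 2].
    rewrite [X in _ `<=` X](iffLR (closure_id _)); last first.
      exact: (closed_sublevel (@mdist_continuous _ _ x)).
    by apply: closure_subset => z /WV[/ltW].
  have cW2 : closure W `<=` [set z | `|f n (phi x) - f n (phi z)| <= eta / 2].
    rewrite [X in _ `<=` X](iffLR (closure_id _)); last first.
      apply: closed_sublevel => z; apply: cvg_norm; apply: cvgB; first exact: cvg_cst.
      by apply: (continuous_comp (cphi z)); exact: cf.
    by apply: closure_subset => z /WV[_ /ltW].
  exists W; split=> //; first by move=> z /cW2 /=; rewrite distrC.
  apply: scoverS sr => _ [z /cW1 /= xz <-]; rewrite /= iso.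
  by rewrite (le_lt_trans xz)// ltr_pdivrMr// ltr_pMr// ltr1n.
have oU x : open (U x) by case: bB => bB _; apply: bB; case: (UP x).
have cbd x : compact (boundary (U x)).
  apply: subclosed_compact cX _ => //; rewrite /boundary setDE.
  apply: closedI; first exact: closed_closure.
  by apply: open_closedC; exact: open_interior.
have dbd x e' : 0 < e' -> gdense (null_fibers n s e' (phi @` boundary (U x))).
  have -> : phi @` boundary (U x) = range (phi \o @set_val _ (boundary (U x))).
    apply/seteqP; split=> [_ [z zU <-]|_ [z _ <-]].
      by exists (exist _ z (mem_set zU)).
    by exists (set_val z) => //; exact: set_valP.
  apply: IH; first exact: compact_set_type.
    by move=> y z; exact: iso.
  by apply: HB; case: (UP x).
have [|l lP] := @compact_seq_cover X X setT U cX.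
  by move=> x _; exists x; apply: open_nbhs_nbhs; split=> //; case: (UP x).
have cphibd x : compact (phi @` boundary (U x)).
  by apply: continuous_compact => //; apply: continuous_subspaceT.
pose F := \big[setU/set0]_(x <- l) (phi @` boundary (U x)).
have cF : compact F by apply: bigsetU_compact => x _; exact: cphibd.
have [f' [cf' f'f f'F]] := @gdense_null_fibers_bigU n s X l
  (fun x => phi @` boundary (U x)) cphibd dbd _ e2 f eta cf eta0.
have [r [N [r0 oN FN HN]]] := fib_thick cK cf' cF (ltW e2) f'F.
have Fbd x : x \in l -> phi @` boundary (U x) `<=` F.
  by move=> xl z Uz; rewrite /F -bigcup_seq; exists x.
pose V i := U (nth x0 l i).
(* For [j < i] the overlap of [A i] and [A j] lies in the boundary of [V j], whose image is in [F]
   and so in [N]; removing [N] makes the pieces [Z i] disjoint. *)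
pose A i := closure (V i) `&` \bigcap_(j in `I_i) ~` V j.
have cA i : closed (A i).
  apply: closedI; first exact: closed_closure.
  by apply: closed_bigI => j _; apply: open_closedC; exact: oU.
pose Z i := if (i < size l)%N then phi @` A i `\` N else set0.
have cZ i : closed (Z i).
  rewrite /Z; case: ifP => _; last exact: closed0.
  rewrite setDE; apply: closedI; last exact: open_closedC.
  apply: compact_closed; first exact: metric_hausdorff.
  apply: continuous_compact; first exact: continuous_subspaceT.
  by apply: subclosed_compact cX _.
have dZ i j : (j < i)%N -> Z i `&` Z j = set0.
  move=> ji; rewrite -subset0 /Z => z []; case: ifP => //= im [[x [_ Ax] xz] _].
  rewrite (ltn_trans ji im) => -[[x' [Ax' _] x'z] Nz].
  apply: Nz; apply: FN; apply: (Fbd (nth x0 l j)).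
    by rewrite mem_nth// (ltn_trans ji im).
  exists x' => //; split=> // Vx'; apply: (Ax j ji).
  by rewrite (injphi x x') ?xz//; exact: interior_subset Vx'.
have fZ i : exists v, forall z, Z i z -> `|f n z - v| <= eta / 2.
  exists (f n (phi (nth x0 l i))) => z; rewrite /Z; case: ifP => // _.
  by move=> [[x [Vx _] <-] _]; case: (UP (nth x0 l i)) => _ _ + _; apply.
have [g [c [cg gf injc gc]]] := separating_constants (size l) eta0 (cf n) cZ dZ fZ.
exists (fun i => if i == n then g else f' i); split.
- by move=> i; case: eqP => _; [exact: cg|exact: cf'].
- by move=> i x; case: eqP => [->|_]; [exact: gf|exact: f'f].
(* The constants are distinct, so off [N] at most one piece can meet the fiber over [y]. *)
move=> y; have [W [sW HW]] : exists W, scover s (e / 2) W /\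
    forall i z, (i < size l)%N -> Z i z -> c i = y n -> W z.
  have [[i [im ci]]|nc] := pselect (exists i, (i < size l)%N /\ c i = y n).
    exists (Z i); split; last first.
      by move=> j z jm Zz cj; rewrite (injc i j) ?ci ?cj.
    case: (UP (nth x0 l i)) => _ _ _; apply: scoverS => z; rewrite /Z im.
    by move=> [[x [Ax _] <-] _]; exists x.
  exists set0; split; first exact/scover0/ltW.
  by move=> i z im _ ci; apply: nc; exists i.
rewrite [e]splitr; apply: scoverS (scoverU (HN y) sW (ltW e2) (ltW e2)).
move=> _ [[x _ <-] yx]; have [Nx|nNx] := pselect (N (phi x)); [left|right].
  split=> // i i_n; have := yx i (ltnW i_n).
  by rewrite (ltn_eqF i_n) => /le_trans; apply; exact: ltW.
have [i0 il Ui] := lP x I.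
have ex : exists i, (i < size l)%N && `[< V i x >].
  exists (index i0 l); rewrite index_mem il; apply/asboolP.
  by rewrite /V nth_index.
(* The first [V i] that contains [x] gives [x] in [A i]. *)
case: (ex_minnP ex) => i /andP[im /asboolP Vx] imin.
have Zx : Z i (phi x).
  rewrite /Z im; split=> //; exists x => //; split; first exact: subset_closure.
  move=> j /= ji Vj; have : (i <= j)%N.
    by apply: imin; rewrite (ltn_trans ji im); exact/asboolP.
  by rewrite leqNgt ji.
apply: (HW i) => //; rewrite -(gc i (phi x))//.
by have := yx n (ltnSn n); rewrite eqxx normr_le0 subr_eq0 => /eqP.
Qed.

End upper_bound.

(** * From sequences to R^n-valued maps *)

(** Negative Hausdorff dimension means empty; each boundary lowers both bounds by one. In
    contrapositive form it turns the assumption on topological dimension into nonnegativity of the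
    claimed maximum. *)
Lemma ind_lt_ind_hausdorff_dim (R : realType) (n : nat) (X : metricType R) :
  (ind_hausdorff_dim n X < n%:R%:E)%E -> ind_lt n X.
Proof.
elim: n X => [|n IH] X /=; case: ifP => [/eqP X0 _|/negbT/set0P X0].
- exact: X0.
- by rewrite ltNge hausdorff_dim_ge0.
- exact: (@ind_lt_le 0 n.+1 X (leq0n _) X0).
move=> /ereal_inf_lt[d [B bB HB] dn]; exists B => // U /HB dU; apply: IH.
apply: le_lt_trans dU _; case: d dn {HB} => [d| |].
- by rewrite -EFinB !lte_fin -natr1 ltrBlDr.
- by [].
- by rewrite addNye => _; exact: ltNyr.
Qed.

(** Each [Q i] has dense interior. Since [meager] demands equality with a union, the complements of
    these interiors are cut down to the complement of [A]. *)
Lemma comeager_bigcap (T : topologicalType) (I : countType) (Q : I -> set T)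
    (A : set T) :
    (forall i (f : T) (V : set T), nbhs f V -> exists2 g, V g & nbhs g (Q i)) ->
    \bigcap_i Q i `<=` A -> comeager A.
Proof.
move=> dQ QA.
exists (fun m => if unpickle m is Some i then ~` A `&` ~` (Q i)° else set0).
  move=> m; rewrite /nowhere_dense -subset0 => f.
  case: unpickle => [i|]; last by rewrite closure0 interior0.
  have cQ : closed (~` (Q i)°) by apply: open_closedC; exact: open_interior.
  move=> fV; have [g cg Qg] := dQ i f _ fV.
  have /(_ g cg) : closure (~` A `&` ~` (Q i)°) `<=` ~` (Q i)°.
    by rewrite [X in _ `<=` X](iffLR (closure_id _) cQ); exact: closure_subset.
  by apply.
apply/seteqP; split=> [f nAf|f [m _]]; last by case: unpickle => [i []|].
have [i nQ] : exists i, ~ (Q i)° f.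
  apply: contrapT => H; apply: nAf; apply: QA => i _.
  by apply: interior_subset; apply: contrapT => nQ; apply: H; exists i.
by exists (pickle i) => //; rewrite pickleK.
Qed.

Section coordinates.
Context {R : realType} {K : metricType R} {n : nat}.
Implicit Types (f h : continuousType K 'rV[R]_n) (g : nat -> K -> R).

Lemma rV_norm_lt (v : 'rV[R]_n) (e : R) : 0 < e ->
  (forall j, `|v 0 j| < e) -> `|v| < e.
Proof.
move=> e0 ve; rewrite /Num.norm/= mx_normrE; apply: bigmax_lt => // -[i j] _.
by rewrite (ord1 i); exact: ve.
Qed.

Lemma rV_norm_coord (v : 'rV[R]_n) j : `|v 0 j| <= `|v|.
Proof.
rewrite [leRHS]/Num.norm/= mx_normrE.
exact: (le_bigmax _ (fun ij => `|v ij.1 ij.2|) (0, j)).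
Qed.

(* Indices beyond [n] are sent to the zero function. *)
Definition crd f (i : nat) (x : K) : R := if insub i is Some j then f x 0 j else 0.

Lemma crdE f (j : 'I_n) x : crd f j x = f x 0 j.
Proof. by rewrite /crd valK. Qed.

Lemma cts_crd f : cts (crd f).
Proof.
move=> i; rewrite /crd; case: insub => [j|]; last exact: cst_continuous.
move=> x; apply: (@continuous_comp _ _ _ f (fun M : 'rV[R]_n => M 0 j)).
  exact: cts_fun.
exact: coord_continuous.
Qed.

Lemma row_continuous g : cts g -> continuous (fun x => \row_(j < n) g j x : 'rV[R]_n).
Proof.
move=> cg x; apply/cvgrPdist_lt => e e0.
have : nbhs x [set z | forall i, (i < n)%N -> `|g i x - g i z| < e].
  by apply: nbhs_nat_forall => i _; have /continuous_distP := cg i; exact.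
apply: filterS => z /= xz; apply: rV_norm_lt => // j.
by rewrite !mxE; exact: xz.
Qed.

Definition mkrow g (cg : cts g) : continuousType K 'rV[R]_n :=
  mkcts (row_continuous cg).

Lemma mkrowE g (cg : cts g) x j : mkrow cg x 0 j = g j x.
Proof. by rewrite /mkrow /= mxE. Qed.

Lemma crd_mkrow g (cg : cts g) i : (i < n)%N -> crd (mkrow cg) i = g i.
Proof.
by move=> i_n; apply/funext => x; rewrite -[i]/(val (Ordinal i_n)) crdE mkrowE.
Qed.

Lemma uclose_crd f h (e : R) : 0 <= e ->
  (forall x, `|f x - h x| < e) -> uclose (crd h) (crd f) e.
Proof.
move=> e0 fh i x; rewrite /crd; case: insub => [j|]; last by rewrite subrr normr0.
rewrite distrC (le_trans _ (ltW (fh x)))// (le_trans _ (rV_norm_coord _ j))//.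
by rewrite !mxE.
Qed.

Lemma uclose_mkrow f g (cg : cts g) (e e' : R) : 0 < e -> e < e' ->
  (forall i x, (i < n)%N -> `|g i x - crd f i x| <= e) ->
  forall x, `|f x - mkrow cg x| < e'.
Proof.
move=> e0 ee' gf x; apply: rV_norm_lt; first exact: lt_trans ee'.
move=> j; rewrite [X in `|X|]mxE [X in _ + X]mxE mkrowE distrC -crdE.
by rewrite (le_lt_trans (gf _ _ _)).
Qed.

Lemma fiberE f y : f @^-1` [set y] =
  fib n (crd f) (fun i => if insub i is Some j then y 0 j else 0) 0.
Proof.
apply/seteqP; split=> [x /= <- i i_n|x fx].
  by rewrite /crd; case: insub => [j|]; rewrite subrr normr0.
apply/rowP => j; have := fx j (ltn_ord j).
by rewrite crdE valK normr_le0 subr_eq0 => /eqP.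
Qed.

(** [P] must depend on the first [n] coordinates only, because forming a row vector discards the
    others. *)
Lemma gdense_nbhs (P : (nat -> K -> R) -> Prop) f
    (V : set (continuousType K 'rV[R]_n)) :
    (forall g g', (forall i, (i < n)%N -> g i = g' i) -> P g -> P g') ->
    gopen P -> gdense P -> nbhs f V ->
  exists2 h, V h & nbhs h [set h | P (crd h)].
Proof.
move=> Pn oP dP /nbhs_continuousTypeE[e e0 eV].
have [g [cg gf Pg]] := dP _ (e / 2) (@cts_crd f) ltac:(by rewrite divr_gt0).
exists (mkrow cg).
  apply: eV => /=; apply: (@uclose_mkrow _ _ _ (e / 2)).
  - by rewrite divr_gt0.
  - by rewrite ltr_pdivrMr// ltr_pMr// ltr1n.
  - by move=> i x _; exact: gf.
have : P (crd (mkrow cg)) by apply: Pn Pg => i i_n; rewrite crd_mkrow.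
move=> /(oP _ (@cts_crd _))[d d0 dPh].
apply/nbhs_continuousTypeE; exists d => // h fh /=.
by apply: dPh; [exact: cts_crd|apply: uclose_crd => //; exact: ltW].
Qed.

End coordinates.

(** * Critical points and robustly large fibers *)

Section critical_point.
Context {R : realType} {K : metricType R}.
Hypothesis cK : compact [set: K].
Variable n : nat.
Implicit Types (C : set K) (s e r : R) (x : K).

Lemma gdense_null_fiberS s e C C' : C' `<=` C ->
  gdense (null_fiber n s e C) -> gdense (null_fiber n s e C').
Proof.
move=> CC' dC f d cf d0; have [g [cg gf Pg]] := dC f d cf d0.
by exists g; split=> //; apply: scoverS Pg; exact: setSI.
Qed.

Lemma negligibleS s C C' : C' `<=` C -> negligible n s C -> negligible n s C'.
Proof. by move=> CC' sC s' e ss' e0; apply: gdense_null_fiberS CC' _; exact: sC. Qed.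

Lemma negligibleU s C1 C2 : compact C1 ->
  negligible n s C1 -> negligible n s C2 -> negligible n s (C1 `|` C2).
Proof.
move=> cC1 s1 s2 s' e ss' e0; have e2 : 0 < e / 2 by rewrite divr_gt0.
rewrite [e]splitr; apply: gdense_null_fiberU => //; try exact: ltW.
- exact: s1.
- exact: s2.
Qed.

Definition cball x r : set K := [set z | mdist x z <= r].

Definition annulus x r' r : set K := [set z | r' <= mdist x z <= r].

Lemma compact_cball x r : compact (cball x r).
Proof.
apply: subclosed_compact cK _ => //.
exact: (closed_sublevel (@mdist_continuous _ _ x)).
Qed.

Lemma compact_annulus x r' r : compact (annulus x r' r).
Proof.
apply: (@subclosed_compact _ _ (cball x r)); [|exact: compact_cball|].
  rewrite (_ : annulus x r' r = [set z | - mdist x z <= - r'] `&` cball x r).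
    apply: closedI; last exact: (closed_sublevel (@mdist_continuous _ _ x)).
    by apply: closed_sublevel => z; apply: cvgN; exact: mdist_continuous.
  by apply/seteqP; split=> z; rewrite /annulus /cball /= lerN2 => /andP.
by move=> z /andP[].
Qed.

(* A small ball around the center costs little content by itself. *)
Lemma negligible_cball s x r : 0 <= s ->
  (forall r', 0 < r' -> negligible n s (annulus x r' r)) ->
  negligible n s (cball x r).
Proof.
move=> s0 H s' e ss' e0; have e2 : 0 < e / 2 by rewrite divr_gt0.
have [r' r'0 sr'] := scover_ball x (le_lt_trans s0 ss') e2.
apply: (@gdense_null_fiberS _ _ (annulus x r' r `|` [set z | mdist x z < r'])).
  by move=> z xz; have [|] := leP r' (mdist x z); [left; apply/andP|right].
rewrite [e]splitr; apply: gdense_null_fiberU; try exact: ltW.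
- exact: compact_annulus.
- exact: H.
- move=> f d cf d0; exists f; split=> //; last by apply: scoverS sr' => z [].
  by move=> i z; rewrite subrr normr0 ltW.
Qed.

(** Otherwise finitely many negligible balls cover [K]. The largest of their exponents is still
    admissible, and the dimension bound for negligible sets is contradicted. *)
Lemma critical_point (x1 : K) : exists x0, forall s r, 0 <= s -> 0 < r ->
  ((s + n%:R)%:E < ind_hausdorff_dim n K)%E -> ~ negligible n s (cball x0 r).
Proof.
apply: contrapT => nx0.
have /choice[sr srP] : forall x, exists sr : R * R, [/\ 0 <= sr.1, 0 < sr.2,
    ((sr.1 + n%:R)%:E < ind_hausdorff_dim n K)%E &
    negligible n sr.1 (cball x sr.2)].
  move=> x; apply: contrapT => Hx; apply: nx0; exists x => s r s0 r0 sn nsr.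
  by apply: Hx; exists (s, r).
have [|l lP] := @compact_seq_cover K K setT (fun x => cball x (sr x).2) cK.
  move=> x _; exists x; apply/nbhs_mdist; exists (sr x).2; first by case: (srP x).
  by move=> y /ltW.
pose B x := cball x (sr x).2.
have [s [s0 sn sB]] : exists s, [/\ 0 <= s,
    ((s + n%:R)%:E < ind_hausdorff_dim n K)%E &
    negligible n s (\big[setU/set0]_(x <- l) B x)].
  elim: (l) => [|x l' [s [s0 sn sB]]].
    (* The empty union also needs an admissible exponent; [x1] supplies it. *)
    exists (sr x1).1; case: (srP x1) => s0 _ sn _; split=> //.
    by rewrite big_nil; move=> s' e _ e0 f d cf d0; exists f; split=> //;
      [move=> i z; rewrite subrr normr0 ltW
      |rewrite /null_fiber set0I; exact/scover0/ltW].
  case: (srP x) => t0 _ tn tB; exists (Num.max s (sr x).1); split.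
  - by rewrite le_max s0.
  - by rewrite maxEle; case: ifP.
  - rewrite big_cons; apply: negligibleU; first exact: compact_cball.
      move=> s' e ss' e0; apply: tB => //; apply: le_lt_trans ss'.
      by rewrite le_max lexx orbT.
    move=> s' e ss' e0; apply: sB => //; apply: le_lt_trans ss'.
    by rewrite le_max lexx.
move: sn; rewrite ltNge => /negP; apply.
apply: (@ind_hausdorff_dim_le_negligible _ _ cK n s setT K idfun) => //.
apply: negligibleS sB => x _; have [c cl cx] := lP x I.
by rewrite -bigcup_seq; exists c.
Qed.

End critical_point.

Section large_fiber.
Context {R : realType} {K : metricType R}.
Hypothesis cK : compact [set: K].
Variable n : nat.

Lemma cts_bounded (g : nat -> K -> R) (x1 : K) : cts g ->
  exists2 M, 0 < M & forall i z, (i < n)%N -> `|g i z| <= M.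
Proof.
move=> cg; have /choice[b bP] : forall i, exists b, forall z, `|g i z| <= b.
  move=> i; have [||c _ cP] := @compact_EVT_max K R (fun z => `|g i z|) setT _ cK.
  - by exists x1.
  - by apply: continuous_subspaceT => z; apply: cvg_norm; exact: cg.
  by exists `|g i c| => z; apply: cP; exact: mem_set.
exists (1 + \sum_(i < n) `|b i|); first by rewrite ltr_pwDl// sumr_ge0.
move=> i z i_n; rewrite (le_trans (bP i z))// (le_trans (ler_norm _))//.
rewrite (bigD1 (Ordinal i_n))//= addrCA lerDl addr_ge0// sumr_ge0//.
Qed.

(** On the annulus the perturbed map minus its value at [x0] is [lam * g]. For any [h] nearby,
    [(h - h x0) / lam] is within [rho] of [g] there, so its zero set, part of the fiber of [h]
    through [x0], has no cheap cover. *)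
Lemma large_fiber_dense (x0 : K) s (f : continuousType K 'rV[R]_n)
    (V : set (continuousType K 'rV[R]_n)) : 0 <= s ->
    (forall r, 0 < r -> ~ negligible n s (cball x0 r)) -> nbhs f V ->
  exists2 g, V g & nbhs g [set h : continuousType K 'rV[R]_n | exists s' e : R,
    [/\ s < s', 0 < e & ~ scover s' e (h @^-1` [set h x0])]].
Proof.
move=> s0 nx0 /nbhs_continuousTypeE[eta eta0 etaV].
pose F := crd f; have cF : cts F := @cts_crd _ _ _ f.
have eta4 : 0 < eta / 4 by rewrite divr_gt0.
have : nbhs x0 [set z | forall i, (i < n)%N -> `|F i x0 - F i z| < eta / 4].
  by apply: nbhs_nat_forall => i _; have /continuous_distP := cF i; exact.
move=> /nbhs_mdist[r1 r1_gt0 Fr].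
pose r := r1 / 2; have r_gt0 : 0 < r by rewrite divr_gt0.
have [r' [r'_gt0 nA]] : exists r', 0 < r' /\ ~ negligible n s (annulus x0 r' r).
  apply: contrapT => H; apply: (nx0 r r_gt0); apply: negligible_cball => // r' r'_gt0.
  by apply: contrapT => nA; apply: H; exists r'.
set A := annulus x0 r' r in nA.
have AF i z : A z -> (i < n)%N -> `|F i x0 - F i z| <= eta / 4.
  move=> /andP[_ xz] i_n; apply/ltW/Fr => //.
  by rewrite (le_lt_trans xz)// ltr_pdivrMr// ltr_pMr// ltr1n.
have [s' [e [ss' e0 nd]]] : exists s' e, [/\ s < s', 0 < e &
    ~ gdense (null_fiber n s' e A)].
  apply: contrapT => H; apply: nA => s' e ss' e0; apply: contrapT => nd.
  by apply: H; exists s', e.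
have [g [rho [cg rho0 gP]]] : exists (g : nat -> K -> R) rho, [/\ cts g, 0 < rho &
    forall g', cts g' -> uclose g' g rho -> ~ null_fiber n s' e A g'].
  apply: contrapT => H; apply: nd => g rho cg rho0; apply: contrapT => ng.
  apply: H; exists g, rho; split=> // g' cg' g'g Pg'.
  by apply: ng; exists g'.
have [M M0 gM] := cts_bounded x0 cg.
(* Then [lam * g] is at most [eta / 4]; adding the oscillation [eta / 4] of [F] stays within the
   clipping level [eta / 2]. *)
pose lam := eta / 4 / M; have lam0 : 0 < lam by rewrite !divr_gt0.
have lamg i z : (i < n)%N -> `|lam * g i z| <= eta / 4.
  move=> i_n; rewrite normrM (gtr0_norm lam0).
  rewrite (le_trans (ler_wpM2l (ltW lam0) (gM i z i_n)))//.
  by rewrite /lam divfK ?gt_eqF.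
(* [psi] vanishes at [x0] and is [1] on the annulus, so [F1] keeps the value at
   [x0] and equals [F x0 + lam * g] on the annulus. *)
pose psi z := clip 1 (mdist x0 z / r').
have cpsi : continuous psi.
  apply: clip_continuous => // z; apply: cvgM; last exact: cvg_cst.
  exact: mdist_continuous.
pose u i z := psi z * (F i x0 - F i z + lam * g i z).
have cu i : continuous (u i).
  move=> z; apply: cvgM; first exact: cpsi.
  apply: cvgD; first by apply: cvgB; [exact: cvg_cst|exact: cF].
  by apply: cvgM; [exact: cvg_cst|exact: cg].
pose F1 i z := F i z + clip (eta / 2) (u i z).
have eta2 : 0 < eta / 2 by rewrite divr_gt0.
have cF1 : cts F1.
  move=> i z; apply: cvgD; first exact: cF.
  exact: (clip_continuous (ltW eta2) (cu i)).
have F1x0 i : F1 i x0 = F i x0.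
  rewrite /F1 /u /psi mdistxx mul0r [clip 1 0]clip_id ?normr0//.
  by rewrite mul0r clip_id ?normr0 ?addr0// ltW.
have F1A i z : A z -> (i < n)%N -> F1 i z = F i x0 + lam * g i z.
  move=> Az i_n; have psi1 : psi z = 1.
    have zr : 1 <= mdist x0 z / r' by rewrite ler_pdivlMr// mul1r; case/andP: Az.
    by rewrite /psi /clip (min_l zr) max_r// (le_trans (lerN10 _)).
  rewrite /F1 /u psi1 mul1r clip_id; first by rewrite addrA addrCA subrr addr0.
  rewrite (le_trans (ler_normD _ _))// [leRHS](_ : _ = eta / 4 + eta / 4); last by field.
  by rewrite lerD ?AF ?lamg.
exists (mkrow cF1).
  apply: etaV => /=; apply: (@uclose_mkrow _ _ _ _ _ _ (eta / 2)) => //.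
    by rewrite ltr_pdivrMr// ltr_pMr// ltr1n.
  by move=> i z _; rewrite /F1 addrC addKr clip_norm// ltW.
(* The errors of [h] at [z] and at [x0] both enter the difference quotient, each at most [d], giving
   [rho] after division by [lam]. *)
pose d := lam * rho / 2; have d0 : 0 < d by rewrite divr_gt0// mulr_gt0.
apply/nbhs_continuousTypeE; exists d => // h fh; exists s', e; split=> // sh.
pose H := crd h; have cH : cts H := @cts_crd _ _ _ h.
have HF1 i z : (i < n)%N -> `|H i z - F1 i z| <= d.
  by move=> i_n; rewrite -(crd_mkrow cF1 i_n); apply: uclose_crd fh _ _; exact: ltW.
pose w i z := (H i z - H i x0) / lam - g i z.
have cw i : continuous (w i).
  move=> z; apply: cvgB; last exact: cg.
  by apply: cvgM; [apply: cvgB; [exact: cH|exact: cvg_cst]|exact: cvg_cst].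
(* [w] is known to be small only on the annulus; clipping makes [g'] uniformly close to [g]
   everywhere without changing it there. *)
pose g' i z := g i z + clip rho (w i z).
apply: (gP g').
- move=> i z; apply: cvgD; first exact: cg.
  exact: (clip_continuous (ltW rho0) (cw i)).
- by move=> i z; rewrite /g' addrC addKr clip_norm// ltW.
apply: scoverS sh => z [Az g'z] /=; apply/rowP => j.
have := g'z j (ltn_ord j); rewrite subr0 normr_le0 /g' clip_id.
  rewrite addrC subrK mulf_eq0 invr_eq0 (gt_eqF lam0) orbF subr_eq0.
  by rewrite /H !crdE => /eqP.
have j_n := ltn_ord j.
have -> : w j z = ((H j z - F1 j z) - (H j x0 - F1 j x0)) / lam.
  rewrite /w F1x0 F1A//; field; exact: lt0r_neq0.
rewrite normrM normfV (gtr0_norm lam0) ler_pdivrMr// (le_trans (ler_normB _ _))//.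
by rewrite mulrC [leRHS]splitr lerD// HF1.
Qed.

End large_fiber.

(** * Combining the two bounds for the generic map *)

Local Open Scope ereal_scope.

Theorem theorem7p1 (R : realType) (n : nat) (K : metricType R)
    (n_gt0 : (0 < n)%N) (K_compact : compact [set: K])
    (dimK : n%:R%:E <= ind_dim R K) :
  comeager [set f : continuousType K 'rV[R]_n |
    let fiber_dims :=
      range (fun y : 'rV[R]_n => hausdorff_dim (f @^-1` [set y])) in
    let m := ind_hausdorff_dim n K - n%:R%:E in
    fiber_dims m /\ ubound fiber_dims m].
Proof.
have [x1 _] : [set: K] !=set0.
  apply/set0P/eqP => K0; move: dimK; rewrite leNgt => /negP; apply.
  have /(ind_ltP (R := R)) : ind_lt 0 K := K0.
  by move/le_lt_trans; apply; rewrite lte_fin sub0r (lt_le_trans (ltrN10 _)).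
have nD : n%:R%:E <= ind_hausdorff_dim n K.
  rewrite leNgt; apply/negP => /ind_lt_ind_hausdorff_dim/(ind_ltP (R := R)) H.
  have := le_trans dimK H; rewrite lee_fin => nn; suff : False by [].
  by move: nn; rewrite leNgt ltrBlDr ltrDl ltr01.
have [x0 x0P] := critical_point K_compact n x1.
have cfib (f : continuousType K 'rV[R]_n) y : compact (f @^-1` [set y]).
  apply: (subclosed_compact _ K_compact) => //.
  apply: preimage_closed; first by move=> z _; exact: cts_fun.
  exact/accessible_closed_set1/hausdorff_accessible/norm_hausdorff.
set D := ind_hausdorff_dim n K in nD x0P *.
(* Countably many conditions suffice: [Q1], with rational exponents, bounds the fiber through [x0]
   from below; [Q2], with tolerances [k.+1%:R^-1], bounds all fibers from above and is vacuous for
   infinite [D]. *)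
pose Q1 (q : rat) := [set f : continuousType K 'rV[R]_n |
  (0 <= ratr q :> R)%R -> (ratr q + n%:R)%R%:E < D ->
  exists s' e : R, [/\ (ratr q < s')%R, (0 < e)%R & ~ scover s' e (f @^-1` [set f x0])]].
pose Q2 (k : nat) := [set f : continuousType K 'rV[R]_n |
  D < +oo -> null_fibers n (fine D - n%:R + k.+1%:R^-1) k.+1%:R^-1 setT (crd f)].
apply: (@comeager_bigcap _ (rat + nat)%type
  (fun i => match i with inl q => Q1 q | inr k => Q2 k end)).
- move=> [q|k] f V fV.
    have [[q0 qD]|nq] := pselect ((0 <= ratr q :> R)%R /\ (ratr q + n%:R)%R%:E < D).
      have [|g Vg Hg] := large_fiber_dense K_compact q0 _ fV (x0 := x0).
        by move=> r r0; exact: x0P.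
      by exists g => //; apply: filterS Hg => h Hh _ _.
    exists f; first exact: nbhs_singleton.
    suff -> : Q1 q = setT by exact: filterT.
    by rewrite -subTset => h _ q0 qD; case: nq.
  have [DE|nD'] := pselect (D < +oo); last first.
    exists f; first exact: nbhs_singleton.
    suff -> : Q2 k = setT by exact: filterT.
    by rewrite -subTset => h _ /nD'.
  have DfE : D = (fine D)%:E.
    by rewrite fineK// fin_numElt DE andbT (lt_le_trans _ nD)// ltNyr.
  have k0 : (0 < k.+1%:R^-1 :> R)%R by rewrite invr_gt0.
  have nfD : (n%:R <= fine D)%R by rewrite -lee_fin -DfE.
  have [|||h Vh Hh] := gdense_nbhs (P := null_fibers n (fine D - n%:R + k.+1%:R^-1)
     k.+1%:R^-1 setT) _ _ _ fV.
  + move=> g g' gg' Hg y; apply: scoverS (Hg y) => z [_ gz]; split=> // i i_n.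
    by rewrite gg'//; exact: gz.
  + by apply: gopen_null_fibers => //; exact: ltW.
  + have -> : [set: K] = range idfun by rewrite image_id.
    apply: (gdense_null_fibers_ind K_compact) => //.
      by rewrite ltr_wpDl// subr_ge0.
    by rewrite -/D DfE lte_fin addrAC subrK ltrDl.
  by exists h => //; apply: filterS Hh => h' ? _.
move=> f fQ /=.
have ub y : hausdorff_dim (f @^-1` [set y]) <= D - n%:R%:E.
  have [DE|] := pselect (D < +oo); last first.
    by move=> /negP; rewrite -leNgt leye_eq => /eqP ->; rewrite leey.
  have DfE : D = (fine D)%:E.
    by rewrite fineK// fin_numElt DE andbT (lt_le_trans _ nD)// ltNyr.
  have nfD : (n%:R <= fine D)%R by rewrite -lee_fin -DfE.
  rewrite DfE -EFinB; apply: (hausdorff_dim_le (phi := idfun)) => //.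
    by rewrite subr_ge0.
  move=> s' e ss' e0.
  have d0 : (0 < Num.min (s' - (fine D - n%:R)) e)%R by rewrite lt_min subr_gt0 ss'.
  have [k] := natr_inv_small d0; rewrite lt_min => /andP[k1 k2].
  rewrite image_id fiberE.
  apply: scover_mono (scoverS _ (fQ (inr k) I DE _)).
  - by rewrite -lerBrDl ltW.
  - exact: ltW.
  - by rewrite invf_le1// ler1n.
  - by move=> z fz; split=> //; exact: fz.
have lb : D - n%:R%:E <= hausdorff_dim (f @^-1` [set f x0]).
  have dim0 : 0 <= hausdorff_dim (f @^-1` [set f x0]).
    by apply: hausdorff_dim_ge0; exists x0.
  rewrite leNgt; apply/negP => dimD.
  (* At such a [q], which for infinite [D] is taken just above the fiber's dimension, every exponent
     [s'] above [q] admits cheap covers of the fiber, against [Q1]. *)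
  have [q qdim qD] : exists2 q : rat, hausdorff_dim (f @^-1` [set f x0]) < (ratr q)%:E &
      (ratr q + n%:R)%R%:E < D.
    move: dim0 dimD; case: hausdorff_dim => [t _|//|//].
      case: (D) => [D'| |//].
        rewrite -EFinB lte_fin => /rat_in_itvoo[q]; rewrite in_itv/= => /andP[? ?].
        by exists q; rewrite lte_fin// -ltrBrDr.
      move=> _; have /rat_in_itvoo[q] : (t < t + 1)%R by rewrite ltrDl.
      by rewrite in_itv/= => /andP[? _]; exists q; rewrite ?lte_fin ?ltry.
    by move=> _; rewrite ltNge leey.
  have q0 : (0 <= ratr q :> R)%R by rewrite -lee_fin (le_trans dim0)// ltW.
  have [s' [e [qs' e0 nsc]]] := fQ (inl q) I q0 qD.
  apply: nsc; rewrite -(image_id (f @^-1` _)).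
  apply: (scover_hausdorff_dim (phi := idfun)) => //.
  - by rewrite image_id.
  - exact: le_lt_trans qs'.
  - by rewrite (lt_trans qdim)// lte_fin.
split; last by move=> _ [y _ <-]; exact: ub.
by exists (f x0) => //; apply/eqP; rewrite eq_le ub lb.
Qed.
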